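(* Let $(X,\leq)$ be a poset of valid structures under the consecutive order, where $X$ is the set of all structures of some valid type. If it is decidable whether a given bicycle in a factor graph of $(X,\leq)$ contains ambiguous paths, then the atomicity problem is decidable for $(X,\leq)$, that is, it is decidable, given a finite set $B\subseteq X$, whether $\mathrm{Av}(B)$ is atomic.
   Context: Conventions: $\mathbb{N}=\{1,2,3,\dots\}$ and $[m,n]=\{m,m+1,\dots,n\}$. Structures. A structure is a pair $(X,R)$ with $X$ a finite subset of $\mathbb{N}$ and $R$ a sequence of relations on $X$, the first of which is the linear order on $X$ inherited from $\mathbb{N}$. The sequence of arities of the relations in $R$ is the signature. Structures are of the same type if they have the same signature and, perhaps, satisfy certain additional conditions. Two structures of the same type are isomorphic ($\cong$) if relabelling the points of each in increasing order by $1,2,\dots$ gives exactly the same structure; isomorphic structures are considered equal, so every structure may be taken to have underlying set $[1,n]$ for some $n\in\mathbb{N}$. The length of $(X,R)$ is $|(X,R)|=|X|$. For $Y\subseteq X$, $\sigma\upharpoonright_Y$ is the restriction of $\sigma$ to the points in $Y$. Consecutive order: for $\sigma,\rho$ of the same type, $\sigma\leq\rho$ iff $\sigma\cong\rho\upharpoonright_{[k,k+|\sigma|-1]}$ for some $k\ge 1$ with $k+|\sigma|-1\le|\rho|$. Valid types. Let $\sigma,\rho$ be structures of the same type with $|\sigma|=p$, $|\rho|=q$. They overlap (on $x$ points) if $\sigma\upharpoonright_{[p-x+1,p]}\cong\rho\upharpoonright_{[1,x]}$ for some $x\geq 1$. A structure $\theta$ of the same type with $|\theta|=p+q-x$ combines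 them if $\theta\upharpoonright_{[1,p]}\cong\sigma$ and $\theta\upharpoonright_{[p-x+1,p+q-x]}\cong\rho$. A type is valid if for any two overlapping structures of this type there is a structure of the same type which combines them. Avoidance sets: $\mathrm{Av}(B)=\{x\in X: \beta\nleq x \text{ for all } \beta\in B\}$. A downward closed subset $C$ of a poset is atomic if it is not the union of two downward closed proper subsets of $C$; equivalently (joint embedding property) for all $x,y\in C$ there is $z\in C$ with $x,y\leq z$. Factor graphs of $(X,\leq)$: let $C=\mathrm{Av}(B)$ with $B\subseteq X$ finite, let $b$ be the maximum length of an element of $B$ ($b=1$ if $B=\varnothing$) and let $m\ge b$. The $m$-dimensional factor graph $\Gamma_C^m$ is the digraph whose vertices are the structures in $C$ of length $m$, with an edge $u\to v$ iff $u\upharpoonright_{[2,m]}\cong v\upharpoonright_{[1,m-1]}$ (loops allowed; for $m=1$ both are restrictions to the empty set). One usually works with $m=b$. A structure $\sigma\in C$ of length $n\ge m$ has the associated path $\Pi(\sigma)=\sigma\upharpoonright_{[1,m]}\to\sigma\upharpoonright_{[2,m+1]}\to\dots\to\sigma\upharpoonright_{[n-m+1,n]}$ in $\Gamma_C^m$. For a path $\pi$ in $\Gamma_C^m$, $\Sigma(\pi)=\{\sigma\in C:|\sigma|\ge m,\ \Pi(\sigma)=\pi\}$, and $\pi$ is ambiguous if $|\Sigma(\pi)|>1$. Digraph notions. A path is a sequence $v_1\to\dots\to v_n$ of vertices joined by edges, of length $n-1$; it is simple if its vertices are distinct. A cycle is a path of length $\ge1$ with $v_1=v_n$; it is simple if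 its only repeated vertex is the start/end vertex. A bicycle consists of two vertex-disjoint simple cycles (the first, initial cycle and the second, terminal cycle) connected by a simple path whose internal vertices are disjoint from both cycles; either or both cycles may be absent, but if neither is absent the connecting path has length at least one.
   Formalization: The formal statement also assumes that it is decidable whether a given structure belongs to the valid type; without this the claim fails, for instance for pair-labelled structures whose allowed labels at distance n depend on an undecidable set. *)

(* Defs.v *)
From Stdlib Require List.
From mathcomp Require Import all_boot.
Set Implicit Arguments.
Unset Strict Implicit.
Unset Printing Implicit Defensive.

(* Programs for the partial recursive functions (Kleene), with sequences of
   arguments; [Proj i] is the i-th argument, from 0. *)
Inductive recf : Type :=
| Zero
| Succ
| Proj of nat
| Comp of recf & seq recf
| Prec of recf & recf
| Mu of recf.

(* [eval f v y]: the computation of f on v halts with value y. *)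
Inductive eval : recf -> seq nat -> nat -> Prop :=
| eval_zero v : eval Zero v 0
| eval_succ x v : eval Succ (x :: v) x.+1
| eval_proj i v : i < size v -> eval (Proj i) v (nth 0 v i)
| eval_comp f gs v ws y :
    size ws = size gs ->
    (forall i, i < size gs -> eval (nth Zero gs i) v (nth 0 ws i)) ->
    eval f ws y -> eval (Comp f gs) v y
| eval_prec0 f g v y : eval f v y -> eval (Prec f g) (0 :: v) y
| eval_precS f g n v z y :
    eval (Prec f g) (n :: v) z -> eval g [:: n, z & v] y ->
    eval (Prec f g) (n.+1 :: v) y
| eval_mu f v n :
    (forall k, k < n -> exists y, eval f (k :: v) y.+1) ->
    eval f (n :: v) 0 -> eval (Mu f) v n.

(* The problem "given an instance a satisfying I, does P a hold?", with
   instances presented to the algorithm as the numbers [code a]. *)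
Definition decidable_problem (A : Type) (code : A -> nat) (I P : A -> Prop) :=
  exists f : recf, forall a, I a ->
    (P a -> eval f [:: code a] 1) /\ (~ P a -> eval f [:: code a] 0).

(* The underlying set is {0, ..., len - 1}, that is, the paper's [1, len]
   shifted by one.  [holds s i t] says that the tuple t is in the i-th relation;
   only its values on tuples of points of s of the arity prescribed by the
   signature are meaningful, and [iso] ignores the others. *)
Record structure := Structure { len : nat; holds : nat -> seq nat -> bool }.

(* All k-tuples of points of {0, ..., n - 1}, in lexicographic order. *)
Fixpoint tuples (n k : nat) : seq (seq nat) :=
  if k is k'.+1 then [seq x :: t | x <- iota 0 n, t <- tuples n k']
  else [:: [::]].

(* A signature sg is the sequence of all the arities, that of the linear order
   (relation 0) included. *)
Definition is_signature (sg : seq nat) : Prop := head 0 sg = 2.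

Definition is_structure (s : structure) : Prop :=
  0 < len s /\
  forall x y, x < len s -> y < len s -> holds s 0 [:: x; y] = (x <= y).

(* As the points are already numbered in increasing order, isomorphic
   structures have the same length and the same relations. *)
Definition iso (sg : seq nat) (s t : structure) : bool :=
  (len s == len t) &&
  all (fun i => all (fun u => holds s i u == holds t i u)
                    (tuples (len s) (nth 0 sg i)))
      (iota 0 (size sg)).

(* The restriction of s to its l consecutive points k, ..., k + l - 1,
   renumbered from 0. *)
Definition window (k l : nat) (s : structure) : structure :=
  Structure l (fun i u => holds s i (map (addn k) u)).

Definition cle (sg : seq nat) (s t : structure) : Prop :=
  exists k, k + len s <= len t /\ iso sg s (window k (len s) t).

(* A type is given by a signature sg and the class X of the structures that
   satisfy its additional conditions; restrictions to intervals of a structure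
   are structures of the same type. *)
Definition is_type (sg : seq nat) (X : structure -> Prop) : Prop :=
  [/\ is_signature sg,
      forall s, X s -> is_structure s,
      forall s t, X s -> iso sg s t -> X t &
      forall s k l, X s -> 0 < l -> k + l <= len s -> X (window k l s)].

Definition overlap (sg : seq nat) (x : nat) (s t : structure) : Prop :=
  [/\ 0 < x, x <= len s, x <= len t &
      iso sg (window (len s - x) x s) (window 0 x t)].

Definition combines (sg : seq nat) (x : nat) (c s t : structure) : Prop :=
  [/\ len c = len s + len t - x,
      iso sg (window 0 (len s) c) s &
      iso sg (window (len s - x) (len t) c) t].

Definition valid (sg : seq nat) (X : structure -> Prop) : Prop :=
  forall s t x, X s -> X t -> overlap sg x s t ->
    exists c, X c /\ combines sg x c s t.

Definition all_in (X : structure -> Prop) (B : seq structure) : Prop :=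
  forall b, List.In b B -> X b.

Definition Av (sg : seq nat) (X : structure -> Prop) (B : seq structure)
    (s : structure) : Prop :=
  X s /\ forall b, List.In b B -> ~ cle sg b s.

Definition down_closed (sg : seq nat) (X D : structure -> Prop) : Prop :=
  forall s t, X s -> D t -> cle sg s t -> D s.

Definition proper_subset (D C : structure -> Prop) : Prop :=
  (forall s, D s -> C s) /\ exists s, C s /\ ~ D s.

Definition atomic (sg : seq nat) (X C : structure -> Prop) : Prop :=
  ~ exists D E : structure -> Prop,
      [/\ down_closed sg X D, down_closed sg X E,
          proper_subset D C, proper_subset E C &
          forall s, C s <-> D s \/ E s].

(* 1 if B is empty; members of B have length at least 1. *)
Definition max_length (B : seq structure) : nat :=
  \big[maxn/1]_(b <- B) len b.

Definition vertex (C : structure -> Prop) (m : nat) (u : structure) : Prop :=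
  C u /\ len u = m.

Definition edge (sg : seq nat) (m : nat) (u v : structure) : bool :=
  iso sg (window 1 m.-1 u) (window 0 m.-1 v).

Definition Pi_path (m : nat) (s : structure) : seq structure :=
  [seq window k m s | k <- iota 0 (len s - m).+1].

Definition Sigma_path (sg : seq nat) (C : structure -> Prop) (m : nat)
    (p : seq structure) (s : structure) : Prop :=
  [/\ C s, m <= len s & all2 (iso sg) (Pi_path m s) p].

Definition ambiguous (sg : seq nat) (C : structure -> Prop) (m : nat)
    (p : seq structure) : Prop :=
  exists s t, [/\ Sigma_path sg C m p s, Sigma_path sg C m p t & ~~ iso sg s t].

(* A cycle v_1 -> ... -> v_n -> v_1 is listed as [:: v_1; ...; v_n], and an
   absent one is [::].  A path is listed with both its endpoints. *)
Record bicycle := Bicycle {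
  initial : seq structure;
  connecting : seq structure;
  terminal : seq structure
}.

(* Vertices are structures up to isomorphism. *)
Definition on (sg : seq nat) (c : seq structure) (u : structure) : bool :=
  has (iso sg u) c.

Definition distinct (sg : seq nat) (c : seq structure) : bool :=
  pairwise (fun u v => ~~ iso sg u v) c.

Definition disjoint_from (sg : seq nat) (c d : seq structure) : bool :=
  all (fun u => ~~ on sg d u) c.

Definition simple_cycle (sg : seq nat) (m : nat) (c : seq structure) : bool :=
  cycle (edge sg m) c && distinct sg c.

Definition simple_path (sg : seq nat) (m : nat) (p : seq structure) : bool :=
  [&& size p > 0, sorted (edge sg m) p & distinct sg p].

(* The connecting path meets a cycle that is present in exactly one vertex,
   its first one for the initial cycle and its last one for the terminal cycle.
   If both cycles are present, their disjointness makes its length positive. *)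
Definition attached (sg : seq nat) (b : bicycle) : bool :=
  if connecting b is x :: p then
    (nilp (initial b) ||
       (on sg (initial b) x && disjoint_from sg p (initial b))) &&
    (nilp (terminal b) ||
       (on sg (terminal b) (last x p) &&
        disjoint_from sg (belast x p) (terminal b)))
  else false.

Definition bicycle_vertices (b : bicycle) : seq structure :=
  initial b ++ connecting b ++ terminal b.

Definition is_bicycle (sg : seq nat) (C : structure -> Prop) (m : nat)
    (b : bicycle) : Prop :=
  all_in (vertex C m) (bicycle_vertices b) /\
  [&& simple_cycle sg m (initial b), simple_cycle sg m (terminal b),
      disjoint_from sg (initial b) (terminal b),
      simple_path sg m (connecting b) & attached sg b].

Definition consecutive (sg : seq nat) (p : seq structure) (u v : structure) :
    bool :=
  has (fun e => iso sg u e.1 && iso sg v e.2) (zip p (behead p)).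

Definition close (c : seq structure) : seq structure := c ++ take 1 c.

Definition bicycle_edge (sg : seq nat) (b : bicycle) (u v : structure) : bool :=
  [|| consecutive sg (close (initial b)) u v,
      consecutive sg (connecting b) u v
    | consecutive sg (close (terminal b)) u v].

(* Paths in the bicycle need not be simple: they may go round its cycles any
   number of times. *)
Definition path_in_bicycle (sg : seq nat) (b : bicycle) (p : seq structure) :
    bool :=
  [&& size p > 0, all (on sg (bicycle_vertices b)) p &
      sorted (bicycle_edge sg b) p].

Definition contains_ambiguous_path (sg : seq nat) (C : structure -> Prop)
    (m : nat) (b : bicycle) : Prop :=
  exists p, path_in_bicycle sg b p /\ ambiguous sg C m p.

(* The length of s, followed by the truth tables of its relations. *)
Definition code_structure (sg : seq nat) (s : structure) : nat :=
  CodeSeq.code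
    (len s :: flatten [seq [seq nat_of_bool (holds s i u)
                             | u <- tuples (len s) (nth 0 sg i)]
                        | i <- iota 0 (size sg)]).

Definition code_structures (sg : seq nat) (c : seq structure) : nat :=
  CodeSeq.code (map (code_structure sg) c).

Definition type_decidable (sg : seq nat) (X : structure -> Prop) : Prop :=
  decidable_problem (code_structure sg) is_structure X.

(* A bicycle in a factor graph is presented with the set B and the dimension m
   that define the graph. *)
Record bicycle_instance := BicycleInstance {
  basis : seq structure;
  dim : nat;
  bic : bicycle
}.

Definition code_bicycle_instance (sg : seq nat) (a : bicycle_instance) : nat :=
  CodeSeq.code [:: code_structures sg (basis a); dim a;
                   code_structures sg (initial (bic a));
                   code_structures sg (connecting (bic a));
                   code_structures sg (terminal (bic a))].

Definition bicycle_ambiguity_decidable (sg : seq nat) (X : structure -> Prop) :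
    Prop :=
  decidable_problem (code_bicycle_instance sg)
    (fun a => [/\ all_in X (basis a), max_length (basis a) <= dim a &
                  is_bicycle sg (Av sg X (basis a)) (dim a) (bic a)])
    (fun a => contains_ambiguous_path sg (Av sg X (basis a)) (dim a) (bic a)).

Definition atomicity_decidable (sg : seq nat) (X : structure -> Prop) : Prop :=
  decidable_problem (code_structures sg) (all_in X)
    (fun B => atomic sg X (Av sg X B)).

(* Main.v *)
Require Import Defs.
From mathcomp Require Import all_boot.
From mathcomp Require Import zify.
From mathcomp.classical Require Import boolp.

(** Write C for Av(B) and fix a dimension m with 1 < m and m at least the
lengths of the members of B.  The class C is atomic if and only if any two of
its members lie below a third one ([atomic_joint]), and this has to be decided.

A member of C of length at least m is read as its trail, the sequence of its
windows of length m, which is a path in the factor graph.  Since consecutive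
vertices overlap on m - 1 >= 1 points, validity turns every path into the trail
of some member of C ([trail_realize]).  So if every vertex reaches every other
one, any two long members can be connected ([strongly_connected_joint]).

Suppose that joint embedding holds and that some vertex does not reach some
other one.  Then there is an arrow v -> u such that u does not reach v
([irreversible_arrow]).  No trail crosses this arrow twice, so two members of C
whose trails cross it can only be placed in a common upper bound with both
crossings at the same position ([crosses_aligned]); hence such a member is
determined by the distances from the crossing to its two ends
([crosses_unique]).  Consequently the vertices that reach v have at most one
predecessor, those reached from u have at most one successor, every arrow other
than v -> u lies before v or after u ([joint_gate]; this is the predicate
[gate]), and no path is ambiguous ([joint_determined]).  A walk without choices
in a finite graph is a lasso, and the two lassos, backwards from v and forwards
from u, make the factor graph a bicycle ([gate_bicycle]).  Conversely, in a graph
with a gate any two paths are factors of one path ([gate_common_path]), and if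
trails determine their structures, a realisation of the long path lies above
both given members ([gate_joint]).  The members of length below m need only be
compared with vertices, or with each other if there is no vertex.

All these conditions become bounded formulas about natural numbers.  The code
of a structure determines it up to isomorphism ([iso_code]), the codes of
vertices are bounded by a function of B, and simple paths and bicycles consist
of lists of distinct vertices.  The functions computed by programs on a given
number of arguments are closed under bounded quantification and contain the
usual operations on coded lists, so the resulting criterion [jointb] is
computable ([computable_jointb]) and correct ([jointbP]).  The two given
decision procedures need not halt outside their instances; they are called only
after a test of the instance ([computable_oracle]). *)

Set Implicit Arguments.
Unset Strict Implicit.
Unset Printing Implicit Defensive.

(** * Functions computed by programs *)

Definition computable (n : nat) (f : seq nat -> nat) : Prop :=
  exists r, forall v, size v = n -> eval r v (f v).

Lemma computable_ext n f g :
  (forall v, size v = n -> f v = g v) -> computable n f -> computable n g.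
Proof. by move=> fg [r Hr]; exists r => v sv; rewrite -fg //; apply: Hr. Qed.

Fixpoint all_computable (n : nat) (fs : seq (seq nat -> nat)) : Prop :=
  if fs is f :: fs' then computable n f /\ all_computable n fs' else True.

Lemma computable_comp n f fs :
  computable (size fs) f -> all_computable n fs ->
  computable n (fun v => f [seq h v | h <- fs]).
Proof.
move=> [r Hr] Hfs.
have [gs [sgs Hgs]] : exists gs, size gs = size fs /\
    forall v, size v = n -> forall i, i < size fs ->
      eval (nth Zero gs i) v (nth 0 [seq h v | h <- fs] i).
  elim: fs Hfs {f r Hr} => [|f fs IH] /=; first by exists [::].
  case=> -[r Hr] /IH [gs [sgs Hgs]]; exists (r :: gs); rewrite /= sgs.
  by split=> // v sv [|i] /= lti; [apply: Hr | apply: Hgs].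
exists (Comp r gs) => v sv.
apply: eval_comp (Hr _ (size_map _ _)); first by rewrite size_map.
by move=> i; rewrite sgs; apply: Hgs.
Qed.

Lemma computable_proj n i : i < n -> computable n (nth 0 ^~ i).
Proof. by move=> lti; exists (Proj i) => v sv; apply: eval_proj; rewrite sv. Qed.

Lemma computable_succ n f : computable n f -> computable n (fun v => (f v).+1).
Proof.
move=> Hf; apply: (@computable_comp n (fun w => (nth 0 w 0).+1) [:: f]) => //.
by exists Succ; case=> [|x [|]] // _; apply: eval_succ.
Qed.

Lemma computable_const n k : computable n (fun=> k).
Proof.
elim: k => [|k IH]; last exact: computable_succ.
by exists Zero => v _; apply: eval_zero.
Qed.

Lemma computable_select n f (js : seq nat) :
  computable (size js) f -> all (gtn n) js ->
  computable n (fun v => f [seq nth 0 v j | j <- js]).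
Proof.
move=> Hf ltjs; pose ps := [seq (nth 0)^~ j | j <- js].
apply: (@computable_ext _ (fun v => f [seq h v | h <- ps])) => [v _|].
  by rewrite -map_comp.
apply: computable_comp; first by rewrite size_map.
rewrite /ps; elim: js ltjs {Hf ps} => //= j js IH /andP[ltj /IH Hjs].
by split=> //; apply: computable_proj.
Qed.

Lemma computable_behead n f :
  computable n f -> computable n.+1 (fun w => f (behead w)).
Proof.
move=> Hf; have := @computable_select n.+1 f (iota 1 n).
rewrite size_iota => /(_ Hf) H; apply: computable_ext (H _) => [v sv|].
  by rewrite map_nth_iota ?sv ?subn1 // drop1 take_oversize // size_behead sv.
by apply/allP => j; rewrite mem_iota => /andP[].
Qed.

Lemma computable_let n (P : nat -> seq nat -> nat) x :
  computable n x -> computable n.+1 (fun w => P (head 0 w) (behead w)) ->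
  computable n (fun v => P (x v) v).
Proof.
move=> Hx HP.
have := @computable_comp n (fun w => P (head 0 w) (behead w))
  (x :: [seq (nth 0)^~ j | j <- iota 0 n]).
rewrite /= size_map size_iota => /(_ HP) H; apply: computable_ext (H _) => [v sv|].
  by rewrite -map_comp [map _ _](map_nth_iota0 0 (eq_leq (esym sv))) -sv take_size.
split=> //; have: all (gtn n) (iota 0 n) by apply/allP => j; rewrite mem_iota.
elim: (iota 0 n) => //= j js IH /andP[ltj /IH Hjs].
by split=> //; apply: computable_proj.
Qed.

(** Below a binder the list of arguments has grown in front, and a function of
the former arguments appears composed with some r that drops the new ones.
Weakenings are the maps r for which such compositions remain computable. *)
Definition weakening (n m : nat) (r : seq nat -> seq nat) : Prop :=
  forall f, computable n f -> computable m (fun w => f (r w)).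

Lemma weakening_id n : weakening n n id.
Proof. by []. Qed.

Lemma weakening_behead n m r :
  weakening n.+1 m r -> weakening n m (fun w => behead (r w)).
Proof. by move=> Hr f /computable_behead Hf; apply: Hr Hf. Qed.

Lemma weakening_behead1 n : weakening n n.+1 behead.
Proof. by move=> f /computable_behead Hf. Qed.

(** The step of a primitive recursion takes the previous value as its second
argument, which the body of a bounded quantifier does not mention. *)
Lemma weakening_skip n :
  weakening n.+1 n.+2 (fun w => head 0 w :: behead (behead w)).
Proof.
move=> f Hf; have := @computable_select n.+2 f (0 :: iota 2 n).
rewrite /= size_iota => /(_ Hf) H; apply: computable_ext (H _) => [|/=].
  case=> [|i [|z v]] //= [sv]; congr (f (_ :: _)).
  by rewrite (map_nth_iota _ (i := 2)) /= ?subn2 ?sv //= drop0 -sv take_size.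
by apply/allP => j; rewrite mem_iota => /andP[].
Qed.

Lemma computable_weaken n m r f :
  weakening n m r -> computable n f -> computable m (fun w => f (r w)).
Proof. by move=> Hr; apply: Hr. Qed.

Lemma computable_head n m r :
  weakening n.+1 m r -> computable m (fun w => head 0 (r w)).
Proof.
move=> Hr; apply: (Hr (head 0)).
apply: computable_ext (computable_proj (ltn0Sn n)) => v sv.
by rewrite nth0.
Qed.

Lemma computable_iteri n b x g :
  computable n b -> computable n x ->
  computable n.+2 (fun w => g (head 0 w) (head 0 (behead w)) (behead (behead w))) ->
  computable n (fun v => iteri (b v) (fun i z => g i z v) (x v)).
Proof.
move=> Hb [rx Hx] [rg Hg].
pose F w := iteri (head 0 w) (fun i z => g i z (behead w)) (x (behead w)).
have HF : computable n.+1 F.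
  exists (Prec rx rg) => -[//|k v] [sv]; rewrite /F /=.
  elim: k => [|k IH] /=; first by apply: eval_prec0; apply: Hx.
  by apply: eval_precS IH _; apply: (Hg [:: _, _ & v]); rewrite /= sv.
apply: (computable_let (P := fun k v => F (k :: v)) Hb).
by apply: computable_ext HF => -[].
Qed.

Lemma computable_mu n f F :
  computable n.+1 f ->
  (forall v k, size v = n -> (f (k :: v) == 0) = (F v <= k)) ->
  computable n F.
Proof.
move=> [r Hr] HF; exists (Mu r) => v sv; apply: eval_mu => [k ltk|].
  exists (f (k :: v)).-1; rewrite prednK; first by apply: Hr; rewrite /= sv.
  by rewrite lt0n HF // leqNgt ltk.
have /eqP <- : f (F v :: v) == 0 by rewrite HF.
by apply: Hr; rewrite /= sv.
Qed.

(** The evaluation of a composition diverges with any of its arguments.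
Primitive recursion on the truth value of c does not run r at all when c fails,
so that r may diverge there. *)
Lemma computable_guard n (c : seq nat -> bool) h r :
  computable n (fun v => c v) ->
  (forall v, size v = n -> c v -> eval r v (h v)) ->
  computable n (fun v => if c v then h v else 0).
Proof.
move=> [rc Hc] Hr; pose ps := [seq Proj i | i <- iota 0 n].
exists (Comp (Prec Zero (Comp r [seq Proj i.+2 | i <- iota 0 n])) (rc :: ps)).
move=> v sv; apply: (@eval_comp _ _ _ (nat_of_bool (c v) :: v)) => [||].
- by rewrite /= size_map size_iota sv.
- case=> [|i] /=; first by move=> _; apply: Hc.
  rewrite size_map size_iota ltnS => lti.
  rewrite (nth_map 0) ?size_iota //= nth_iota // add0n.
  by apply: eval_proj; rewrite sv.
case: ifP => cv; last by apply: eval_prec0; apply: eval_zero.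
apply: (@eval_precS _ _ 0 _ 0); first by apply: eval_prec0; apply: eval_zero.
apply: (@eval_comp _ _ _ v); last exact: Hr.
  by rewrite size_map size_iota.
move=> i; rewrite size_map size_iota => lti.
rewrite (nth_map 0) ?size_iota //= nth_iota // add0n.
by apply: (@eval_proj i.+2); rewrite /= sv.
Qed.

Ltac lift_variables :=
  repeat first [exact: weakening_id | exact: weakening_behead1
               | apply: weakening_behead].

Lemma computable_pred n a : computable n a -> computable n (fun v => (a v).-1).
Proof.
move=> Ha; apply: (@computable_ext _ (fun v => iteri (a v) (fun i _ => i) 0)).
  by move=> v _; case: (a v).
apply: (@computable_iteri _ _ _ (fun i _ _ => i)) => //.
  exact: computable_const.
by apply: computable_head; lift_variables.
Qed.

Lemma computable_add n a b :
  computable n a -> computable n b -> computable n (fun v => a v + b v).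
Proof.
move=> Ha Hb.
apply: (@computable_ext _ (fun v => iteri (b v) (fun _ z => z.+1) (a v))).
  by move=> v _; elim: (b v) => /= [|k ->]; rewrite ?addn0 ?addnS.
apply: (@computable_iteri _ _ _ (fun _ z _ => z.+1)) => //.
by apply: computable_succ; apply: computable_head; lift_variables.
Qed.

Lemma computable_sub n a b :
  computable n a -> computable n b -> computable n (fun v => a v - b v).
Proof.
move=> Ha Hb.
apply: (@computable_ext _ (fun v => iteri (b v) (fun _ z => z.-1) (a v))).
  by move=> v _; elim: (b v) => /= [|k ->]; rewrite ?subn0 ?subnS.
apply: (@computable_iteri _ _ _ (fun _ z _ => z.-1)) => //.
by apply: computable_pred; apply: computable_head; lift_variables.
Qed.

Lemma computable_mul n a b :
  computable n a -> computable n b -> computable n (fun v => a v * b v).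
Proof.
move=> Ha Hb.
apply: (@computable_ext _ (fun v => iteri (b v) (fun _ z => z + a v) 0)).
  by move=> v _; elim: (b v) => /= [|k ->]; rewrite ?muln0 // mulnS addnC.
apply: (@computable_iteri _ _ _ (fun _ z v => z + a v)) => //.
  exact: computable_const.
apply: computable_add; first by apply: computable_head; lift_variables.
by apply: computable_weaken Ha; lift_variables.
Qed.

Lemma computable_exp n a b :
  computable n a -> computable n b -> computable n (fun v => a v ^ b v).
Proof.
move=> Ha Hb.
apply: (@computable_ext _ (fun v => iteri (b v) (fun _ z => z * a v) 1)).
  by move=> v _; elim: (b v) => /= [|k ->]; rewrite ?expn0 // expnSr.
apply: (@computable_iteri _ _ _ (fun _ z v => z * a v)) => //.
  exact: computable_const.
apply: computable_mul; first by apply: computable_head; lift_variables.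
by apply: computable_weaken Ha; lift_variables.
Qed.

Lemma computable_not n (a : seq nat -> bool) :
  computable n (fun v => a v) -> computable n (fun v => ~~ a v).
Proof.
move=> Ha; apply: computable_ext (computable_sub (computable_const n 1) Ha).
by move=> v _; case: (a v).
Qed.

Lemma computable_and n (a b : seq nat -> bool) :
  computable n (fun v => a v) -> computable n (fun v => b v) ->
  computable n (fun v => a v && b v).
Proof.
move=> Ha Hb; apply: computable_ext (computable_mul Ha Hb).
by move=> v _; rewrite mulnb.
Qed.

Lemma computable_or n (a b : seq nat -> bool) :
  computable n (fun v => a v) -> computable n (fun v => b v) ->
  computable n (fun v => a v || b v).
Proof.
move=> /computable_not Ha /computable_not Hb.
apply: computable_ext (computable_not (computable_and Ha Hb)).
by move=> v _; rewrite negb_and !negbK.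
Qed.

Lemma computable_imp n (a b : seq nat -> bool) :
  computable n (fun v => a v) -> computable n (fun v => b v) ->
  computable n (fun v => a v ==> b v).
Proof.
move=> /computable_not Ha Hb; apply: computable_ext (computable_or Ha Hb).
by move=> v _; rewrite implybE.
Qed.

Lemma computable_leq n a b :
  computable n a -> computable n b -> computable n (fun v => a v <= b v).
Proof.
move=> Ha Hb.
have Hd := computable_sub (computable_const n 1) (computable_sub Ha Hb).
apply: computable_ext Hd => v _.
by rewrite -subn_eq0; case: (a v - b v) => // k; rewrite subSS sub0n.
Qed.

Lemma computable_eq n a b :
  computable n a -> computable n b -> computable n (fun v => a v == b v).
Proof.
move=> Ha Hb; have := computable_and (computable_leq Ha Hb) (computable_leq Hb Ha).
by apply: computable_ext => v _; rewrite eqn_leq.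
Qed.

Lemma computable_eqb n (a b : seq nat -> bool) :
  computable n (fun v => a v) -> computable n (fun v => b v) ->
  computable n (fun v => a v == b v).
Proof.
move=> Ha Hb; apply: computable_ext (computable_eq Ha Hb).
by move=> v _; case: (a v); case: (b v).
Qed.

Lemma computable_all n b (P : nat -> seq nat -> bool) :
  computable n b -> computable n.+1 (fun w => P (head 0 w) (behead w)) ->
  computable n (fun v => all (P ^~ v) (iota 0 (b v))).
Proof.
move=> Hb HP.
have := @computable_iteri n b (fun=> 1) (fun i z v => z * P i v) Hb.
move=> /(_ (computable_const _ _)) H.
apply: computable_ext (H _) => [v _|].
  elim: (b v) => // k IH; rewrite iteriS IH mulnb.
  by rewrite -(addn1 k) iotaD all_cat /= andbT.
apply: computable_mul; first by apply: computable_head; lift_variables.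
exact: (weakening_skip HP).
Qed.

Lemma computable_has n b (P : nat -> seq nat -> bool) :
  computable n b -> computable n.+1 (fun w => P (head 0 w) (behead w)) ->
  computable n (fun v => has (P ^~ v) (iota 0 (b v))).
Proof.
move=> Hb /computable_not HP.
have := computable_all (P := fun x v => ~~ P x v) Hb HP.
move/computable_not; apply: computable_ext => v _.
by rewrite all_predC negbK.
Qed.

Lemma computable_all_const (n : nat) (T : Type) (s : seq T) (P : T -> seq nat -> bool) :
  (forall x, computable n (fun v => P x v)) ->
  computable n (fun v => all (P ^~ v) s).
Proof.
move=> HP; elim: s => [|x s IH] /=; first exact: computable_const.
exact: computable_and.
Qed.

(** * Arithmetic of coded lists *)

Local Notation decode := CodeSeq.decode.

(** Builds a program by following the term.  The order of the rules matters,
as they are unified up to conversion: an [all] over an interval that ends in a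
successor unfolds to a conjunction, and a power to a product or a sum. *)
Ltac computable_by tac :=
  repeat first
    [ assumption
    | apply: computable_const
    | solve [apply: computable_head; lift_variables]
    | tac
    | apply: computable_all | apply: computable_has
    | apply: computable_exp | apply: computable_mul | apply: computable_add
    | apply: computable_sub | apply: computable_succ | apply: computable_pred
    | apply: computable_not | apply: computable_and | apply: computable_or
    | apply: computable_imp
    | apply: computable_leq | apply: computable_eq | apply: computable_eqb
    | solve [apply: computable_weaken; [|eassumption]; lift_variables] ].

Lemma computable_div n a b :
  computable n a -> computable n b -> computable n (fun v => a v %/ b v).
Proof.
move=> Ha Hb; pose c w := (0 < b (behead w)) &&
  ((head 0 w).+1 * b (behead w) <= a (behead w)).
have Hc : computable n.+1 (fun w => c w) by rewrite /c; computable_by fail.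
apply: computable_mu Hc _ => v k _; rewrite /c /= eqb0.
case: posnP => [->|b0]; first by rewrite divn0.
by rewrite -ltnNge -ltn_divLR.
Qed.

Lemma computable_mod n a b :
  computable n a -> computable n b -> computable n (fun v => a v %% b v).
Proof.
move=> Ha Hb; apply: (@computable_ext _ (fun v => a v - a v %/ b v * b v)).
  by move=> v _; rewrite [X in X - _](divn_eq _ (b v)) addKn.
by computable_by ltac:(apply: computable_div).
Qed.

Lemma computable_dvd n a b :
  computable n a -> computable n b -> computable n (fun v => a v %| b v).
Proof. by move=> Ha Hb; apply: computable_eq (computable_const n 0);
  apply: computable_mod. Qed.

(** The code of x :: s is 2 ^ x times an odd number. *)
Lemma head_decode N : head 0 (decode N) = logn 2 N.
Proof.
rewrite -[in RHS](CodeSeq.decodeK N); case: (decode N) => [|h s] /=.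
  by rewrite logn0.
by rewrite lognM ?expn_gt0 // pfactorK // lognE /= dvdn2 /= odd_double /= addn0.
Qed.

Lemma behead_decode N :
  behead (decode N) = decode (N %/ 2 ^ (logn 2 N).+1).
Proof.
rewrite -head_decode -{1 2}(CodeSeq.decodeK N).
case: (decode N) => [|h s]; first by [].
rewrite CodeSeq.codeK /= expnSr divnMA mulKn ?expn_gt0 //.
by rewrite divn2 /= uphalf_double CodeSeq.codeK.
Qed.

Lemma computable_head_decode n a :
  computable n a -> computable n (fun v => head 0 (decode (a v))).
Proof.
move=> Ha; apply: (@computable_ext _ (fun v => logn 2 (a v))) => [v _|].
  by rewrite head_decode.
pose c w := (0 < a (behead w)) && (2 ^ (head 0 w).+1 %| a (behead w)).
have Hc : computable n.+1 (fun w => c w).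
  by rewrite /c; computable_by ltac:(apply: computable_dvd).
apply: computable_mu Hc _ => v k _; rewrite /c /= eqb0.
case: posnP => [->|a0]; first by rewrite logn0.
by rewrite pfactor_dvdn // -leqNgt.
Qed.

Definition drop_code N i := iteri i (fun _ M => M %/ 2 ^ (head 0 (decode M)).+1) N.

Lemma drop_codeE N i : decode (drop_code N i) = drop i (decode N).
Proof.
elim: i => [|i IH]; first by rewrite drop0.
by rewrite /drop_code iteriS -/(drop_code N i) head_decode -behead_decode IH -drop1 drop_drop.
Qed.

Lemma computable_drop_code n a i :
  computable n a -> computable n i -> computable n (fun v => drop_code (a v) (i v)).
Proof.
move=> Ha Hi; apply: (@computable_iteri _ _ _ (fun _ M _ => M %/ _)) => //.
by computable_by ltac:(first [apply: computable_div | apply: computable_head_decode]).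
Qed.

Lemma computable_nth n a i :
  computable n a -> computable n i ->
  computable n (fun v => nth 0 (decode (a v)) (i v)).
Proof.
move=> Ha Hi; have := computable_head_decode (computable_drop_code Ha Hi).
by apply: computable_ext => v _; rewrite drop_codeE -nth0 nth_drop addn0.
Qed.

Lemma computable_size n a :
  computable n a -> computable n (fun v => size (decode (a v))).
Proof.
move=> Ha; pose c w := drop_code (a (behead w)) (head 0 w).
have Hc : computable n.+1 c.
  by rewrite /c; computable_by ltac:(apply: computable_drop_code).
apply: computable_mu Hc _ => v k _; rewrite /c /=.
rewrite -subn_eq0 -size_drop -drop_codeE.
by rewrite -[in LHS](CodeSeq.decodeK (drop_code _ _)); case: (decode _) => //= h s;
  rewrite muln_eq0 expn_eq0.
Qed.

Lemma code_cons x s : CodeSeq.code (x :: s) = 2 ^ x * (2 * CodeSeq.code s).+1.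
Proof. by rewrite mul2n. Qed.

Lemma computable_code_cons n a s :
  computable n a -> computable n (fun v => CodeSeq.code (s v)) ->
  computable n (fun v => CodeSeq.code (a v :: s v)).
Proof.
move=> Ha Hs; apply: (@computable_ext _ (fun v =>
  2 ^ a v * (2 * CodeSeq.code (s v)).+1)).
  by move=> v _; rewrite code_cons.
by computable_by fail.
Qed.

Lemma computable_all_decode n a (P : nat -> seq nat -> bool) :
  computable n a -> computable n.+1 (fun w => P (head 0 w) (behead w)) ->
  computable n (fun v => all (P ^~ v) (decode (a v))).
Proof.
move=> Ha HP.
pose Q i v := (i < size (decode (a v))) ==> P (nth 0 (decode (a v)) i) v.
apply: (@computable_ext _ (fun v => all (Q ^~ v) (iota 0 (size (decode (a v)))))).
  move=> v _; congr nat_of_bool;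
    rewrite -[in RHS](mkseq_nth 0 (decode (a v))) /mkseq all_map.
  by apply: eq_in_all => i; rewrite mem_iota /Q /= add0n => ->.
apply: computable_all; first exact: computable_size.
rewrite /Q; apply: computable_imp.
  by computable_by ltac:(apply: computable_size).
have Hn : computable n.+1 (fun w => nth 0 (decode (a (behead w))) (head 0 w)).
  by computable_by ltac:(apply: computable_nth).
apply: (computable_let (P := fun x w => P x (behead w)) Hn).
exact: (weakening_skip HP).
Qed.

Lemma computable_has_decode n a (P : nat -> seq nat -> bool) :
  computable n a -> computable n.+1 (fun w => P (head 0 w) (behead w)) ->
  computable n (fun v => has (P ^~ v) (decode (a v))).
Proof.
move=> Ha /computable_not HP.
have := computable_all_decode (P := fun x v => ~~ P x v) Ha HP.
move/computable_not; apply: computable_ext => v _.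
by rewrite all_predC negbK.
Qed.

(** * Codes of structures *)

(** The position of u in [tuples n (size u)]; [digits] is the inverse. *)
Fixpoint rank (n : nat) (u : seq nat) : nat :=
  if u is x :: u' then x * n ^ size u' + rank n u' else 0.

Fixpoint digits (n k j : nat) : seq nat :=
  if k is k'.+1 then j %/ n ^ k' :: digits n k' (j %% n ^ k') else [::].

Lemma size_digits n k j : size (digits n k j) = k.
Proof. by elim: k j => //= k IH j; rewrite IH. Qed.

Lemma rank_digits n k j : j < n ^ k -> rank n (digits n k j) = j.
Proof.
elim: k j => [|k IH] j; first by rewrite expn0; case: j.
move=> ltj; rewrite /= size_digits IH -?divn_eq // ltn_mod.
by move: ltj; rewrite expnS; case: (n ^ k) => //; rewrite muln0.
Qed.

Lemma tuplesE n k : tuples n k = [seq digits n k j | j <- iota 0 (n ^ k)].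
Proof.
elim: k => [|k IH] //=; rewrite IH expnS; set L := n ^ k; clearbody L.
suff H p : [seq x :: t | x <- iota 0 p, t <- [seq digits n k j | j <- iota 0 L]] =
    [seq j %/ L :: digits n k (j %% L) | j <- iota 0 (p * L)] by exact: H.
elim: p => [|p IHp] //.
have -> : p.+1 * L = p * L + L by rewrite mulSn addnC.
rewrite -(addn1 p) !iotaD allpairs_cat map_cat IHp; congr (_ ++ _).
rewrite /= cats0 !add0n -[p * L]addn0 iotaDl -!map_comp.
apply/eq_in_map => j; rewrite mem_iota /= => ltj.
by rewrite divnMDl 1?modnMDl ?divn_small ?modn_small ?addn0 //; case: (L) ltj.
Qed.

Lemma mem_tuples n k u : (u \in tuples n k) = (size u == k) && all (gtn n) u.
Proof.
elim: k u => [|k IH] [|x u] //=.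
  by apply/negbTE/allpairsPdep => -[? [? []]].
rewrite eqSS; apply/allpairsPdep/idP => [[y [t [Hy Ht [-> ->]]]]|].
  by move: Hy Ht; rewrite mem_iota IH add0n => /= -> /andP[-> ->].
by case/and3P=> su xn un; exists x, u; rewrite mem_iota IH su un.
Qed.

Lemma nth_flatten_cat (T : Type) (x0 : T) (f : nat -> seq T) (k i j : nat) :
  i < k -> j < size (f i) ->
  nth x0 (flatten [seq f i | i <- iota 0 k]) (sumn [seq size (f i) | i <- iota 0 i] + j)
  = nth x0 (f i) j.
Proof.
move=> ltik ltj; rewrite -(subnKC ltik) -addn1 -addnA !iotaD !map_cat !flatten_cat.
rewrite nth_cat size_flatten /shape -map_comp ltnNge leq_addr /= addKn.
by rewrite cats0 nth_cat ltj.
Qed.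

Section Coding.
Variable sg : seq nat.
Local Notation c := (code_structure sg).
Local Notation ar := (nth 0 sg).

(** The place where the table of the i-th relation starts among the truth tables
of a structure of length n. *)
Definition offset n i := sumn [seq n ^ ar k | k <- iota 0 i].

(** Defined on all numbers; the entry 0 of the coded list is the length, so the
tables are shifted by one. *)
Definition dec (N : nat) : structure :=
  let l := decode N in
  Structure (head 0 l)
    (fun i u => nth 0 l (offset (head 0 l) i + rank (head 0 l) u).+1 == 1).

Arguments dec : simpl never.
Arguments code_structure : simpl never.

Lemma decode_code_structure s :
  decode (c s) =
  len s :: flatten [seq [seq nat_of_bool (holds s i u) | u <- tuples (len s) (ar i)]
                   | i <- iota 0 (size sg)].
Proof. exact: CodeSeq.codeK. Qed.

Lemma len_dec s : len (dec (c s)) = len s.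
Proof. by rewrite /dec /= decode_code_structure. Qed.

Lemma holds_dec s i u :
  i < size sg -> u \in tuples (len s) (ar i) ->
  holds (dec (c s)) i u = holds s i u.
Proof.
move=> lti; rewrite tuplesE => /mapP[j]; rewrite mem_iota => /= ltj ->.
rewrite /dec /= decode_code_structure /= rank_digits //.
pose f i := [seq nat_of_bool (holds s i u) | u <- tuples (len s) (ar i)].
have sf k : size (f k) = len s ^ ar k by rewrite size_map tuplesE size_map size_iota.
rewrite -[offset _ _](congr1 sumn (eq_map sf _)) (@nth_flatten_cat _ _ f) ?sf //.
rewrite /f tuplesE (nth_map [::]) ?size_map ?size_iota //.
by rewrite (nth_map 0) ?size_iota // nth_iota // add0n; case: (holds _ _ _).
Qed.

Lemma isoP s t :
  reflect (len s = len t /\ forall i u, i < size sg -> u \in tuples (len s) (ar i) ->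
             holds s i u = holds t i u) (iso sg s t).
Proof.
apply: (iffP andP) => -[/eqP ls H].
  split=> // i u lti Hu; have Hi : i \in iota 0 (size sg) by rewrite mem_iota.
  exact/eqP/(allP (allP H i Hi)).
rewrite ls; split=> //; apply/allP => i; rewrite mem_iota => /= lti.
by apply/allP => u Hu; rewrite H.
Qed.

Lemma iso_code s t : iso sg s t = (c s == c t).
Proof.
apply/isoP/eqP => [[ls H]|E]; last first.
  have ls : len s = len t by rewrite -len_dec E len_dec.
  split=> // i u lti Hu; rewrite -holds_dec // E holds_dec //.
  by rewrite -ls.
rewrite /code_structure -ls; congr (CodeSeq.code (_ :: flatten _)).
apply/eq_in_map => i; rewrite mem_iota => /= lti.
by apply/eq_in_map => u Hu; rewrite H.
Qed.

Lemma code_dec_code s : c (dec (c s)) = c s.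
Proof.
apply/eqP; rewrite eq_sym -iso_code; apply/isoP; rewrite len_dec; split=> // i u *.
by rewrite holds_dec.
Qed.

(** The numbers N that [dec] inverts exactly and for which [dec N] carries the
order of the natural numbers as its first relation. *)
Definition well_coded (N : nat) : bool :=
  let l := decode N in let n := head 0 l in
  [&& 0 < n, size l == (offset n (size sg)).+1,
      all (fun i => (0 < i) ==> (nth 0 l i <= 1)) (iota 0 (size l)) &
      all (fun x => all (fun y => holds (dec N) 0 [:: x; y] == (x <= y)) (iota 0 n))
          (iota 0 n)].

Hypothesis sg_sig : is_signature sg.

Lemma pair_in_tuples n x y : x < n -> y < n -> [:: x; y] \in tuples n (ar 0).
Proof. by move=> xn yn; rewrite nth0 sg_sig mem_tuples /= xn yn. Qed.

Lemma size_sig : 0 < size sg.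
Proof. by move: sg_sig; rewrite /is_signature; case: sg. Qed.

Lemma well_coded_code s : is_structure s -> well_coded (c s).
Proof.
move=> [s0 Hs]; have nE : head 0 (decode (c s)) = len s := len_dec s.
have sE : size (decode (c s)) = (offset (len s) (size sg)).+1.
  rewrite decode_code_structure /= size_flatten /shape -map_comp.
  congr (sumn _).+1; apply: eq_map => i /=.
  by rewrite size_map tuplesE size_map size_iota.
rewrite /well_coded nE sE; apply/and4P; split=> //; last first.
  apply/allP => x; rewrite mem_iota => xn; apply/allP => y; rewrite mem_iota => yn.
  by rewrite (holds_dec size_sig (pair_in_tuples xn yn)) Hs.
apply/allP => i; rewrite mem_iota add0n => /= lti; apply/implyP.
case: i lti => // i; rewrite ltnS => lti _.
rewrite decode_code_structure /=; set l := flatten _.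
have: all (geq 1) l.
  apply/allP => x /flattenP[t /mapP[k _ ->] /mapP[u _ ->]].
  by case: (holds _ _ _).
move/all_nthP; apply; move: sE; rewrite decode_code_structure /= => -[sE].
by rewrite sE.
Qed.

Lemma well_coded_structure N : well_coded N -> is_structure (dec N).
Proof.
case/and4P=> n0 _ _ /allP H; split=> // x y xn yn.
have Hx : x \in iota 0 (len (dec N)) by rewrite mem_iota.
have Hy : y \in iota 0 (len (dec N)) by rewrite mem_iota.
exact: (eqP (allP (H x Hx) y Hy)).
Qed.

Lemma flatten_blocks (T : Type) (x0 : T) (l : seq T) (w : nat -> nat) k o :
  size l = o + sumn [seq w i | i <- iota 0 k] ->
  flatten [seq [seq nth x0 l (o + sumn [seq w i | i <- iota 0 i] + j) |
    j <- iota 0 (w i)]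
          | i <- iota 0 k] = drop o l.
Proof.
move=> sl; set S := fun i => sumn [seq w i | i <- iota 0 i].
suff H p : p <= k -> flatten [seq [seq nth x0 l (o + S i + j) | j <- iota 0 (w i)]
          | i <- iota 0 p] = take (S p) (drop o l).
  by rewrite H // take_oversize // size_drop sl addKn.
elim: p => [|p IH] ltp; first by rewrite take0.
rewrite -(addn1 p) iotaD map_cat flatten_cat IH ?(ltnW ltp) //= cats0 add0n.
have -> : S (p + 1) = S p + w p by rewrite /S iotaD map_cat sumn_cat /= addn0.
have leS : S p + w p <= sumn [seq w i | i <- iota 0 k].
  have -> : S p + w p = S (p + 1) by rewrite /S iotaD map_cat sumn_cat /= addn0.
  by rewrite /S addn1 -(subnKC ltp) iotaD map_cat sumn_cat leq_addr.
rewrite takeD drop_drop; congr (_ ++ _); rewrite [S p + o]addnC.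
rewrite -(map_nth_iota x0); last by rewrite sl; lia.
by rewrite -[o + S p in RHS]addn0 iotaDl -map_comp.
Qed.

Lemma dec_wellK N : well_coded N -> c (dec N) = N.
Proof.
case/and4P=> n0 /eqP sl /allP le1 _; rewrite -[RHS]CodeSeq.decodeK.
congr CodeSeq.code; move: n0 sl le1; set l := decode N => n0 sl le1.
rewrite /dec /= -/l; set n := head 0 l.
have lE : l = n :: behead l by rewrite /n; case: (l) n0.
rewrite [RHS]lE; congr (_ :: _); rewrite -drop1.
rewrite -(@flatten_blocks _ 0 l (fun i => n ^ ar i) (size sg) 1); last by rewrite sl.
congr flatten; apply/eq_in_map => i; rewrite mem_iota add0n => /= lti.
rewrite tuplesE -map_comp; apply/eq_in_map => j; rewrite mem_iota add0n => /= ltj.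
rewrite -/l -/n rank_digits //; set p := (_ + _).+1.
have ltp : p < size l.
  rewrite sl ltnS -(subnKC lti) /offset iotaD map_cat sumn_cat -addn1 iotaD map_cat sumn_cat.
  by rewrite /= addn0 -addnA ltn_add2l ltn_addr.
have := le1 p; rewrite mem_iota => /(_ ltp) /=. rewrite -addnA add1n -/(offset n i) -/p.
by case: (nth 0 l p) => [|[]].
Qed.

End Coding.

(** * Digraphs with a one-way arrow *)

Section Digraph.
Variable T : eqType.
Implicit Types (g h : rel T) (p q s : seq T) (a b x y : T).

Definition reach g x y : Prop := exists2 p, path g x p & last x p = y.

Lemma reach_refl g x : reach g x x.
Proof. by exists [::]. Qed.

Lemma reach_edge g x y : g x y -> reach g x y.
Proof. by move=> gxy; exists [:: y]; rewrite //= gxy. Qed.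

Lemma reach_trans g x y z : reach g x y -> reach g y z -> reach g x z.
Proof.
move=> [p gp lp] [q gq lq]; exists (p ++ q); last by rewrite last_cat lp.
by rewrite cat_path gp lp.
Qed.

Lemma reach_rev g x y : reach g x y -> reach (fun a b => g b a) y x.
Proof.
move=> [p gp <-]; exists (rev (belast x p)).
  by rewrite rev_path.
by case: p {gp} => //= y' p; rewrite rev_cons last_rcons.
Qed.

Lemma path_reach g x p y : path g x p -> y \in x :: p -> reach g x y.
Proof.
move=> gp /splitPl yp; case: yp gp => p1 p2 <-.
by rewrite cat_path => /andP[gp1 _]; exists p1.
Qed.

Lemma reach_mem g (V : pred T) x y :
  (forall a b, g a b -> V b) -> V x -> reach g x y -> V y.
Proof.
move=> gV Vx [p + <-]; elim: p x Vx => //= z p IH x _ /andP[gxz].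
by apply: IH; apply: gV gxz.
Qed.

(** No choice ever arises along the walk from x. *)
Lemma deterministic_path g x p q :
  (forall a b b', reach g x a -> g a b -> g a b' -> b = b') ->
  path g x p -> path g x q -> size p <= size q -> p = take (size p) q.
Proof.
elim: p x q => [|y p IH] x [|y' q] //= det.
move=> /andP[gxy gp] /andP[gxy' gq]; rewrite ltnS => le_pq.
have E : y' = y by apply: det gxy' gxy; apply: reach_refl.
rewrite {}E in gq *; congr (_ :: _); apply: (IH y) => // a b b' ra.
by apply: det; apply: reach_trans (reach_edge gxy) ra.
Qed.

Definition arcs (p : seq T) : seq (T * T) := zip p (behead p).

(** A cycle is listed without repeating its first vertex, which is put back here
so that the closing arc is among the [arcs]. *)
Definition closed_walk (c : seq T) : seq T := c ++ take 1 c.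

Lemma arcs_cat s1 a s2 : arcs (s1 ++ a :: s2) = arcs (rcons s1 a) ++ arcs (a :: s2).
Proof.
elim: s1 => [|x [|y s1] IH] //.
by rewrite /arcs /= in IH *; rewrite IH.
Qed.

Lemma arcs_rcons x p b :
  arcs (rcons (x :: p) b) = rcons (arcs (x :: p)) (last x p, b).
Proof. by rewrite {1}lastI -cats1 cat_rcons arcs_cat -lastI cats1. Qed.

Lemma arcs_rev p a b : ((a, b) \in arcs (rev p)) = ((b, a) \in arcs p).
Proof.
elim: p => [|x [|y p] IH] //.
rewrite 2!rev_cons -cats1 cat_rcons arcs_cat -rev_cons mem_cat IH.
by rewrite /arcs /= !inE orbC !xpair_eqE andbC.
Qed.

Lemma arcs_mem p a b : (a, b) \in arcs p -> (a \in p) && (b \in p).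
Proof.
elim: p => [|x [|y p] IH] //; rewrite /arcs /= inE => /predU1P[[-> ->]|].
  by rewrite !inE !eqxx orbT.
by move/IH => /andP[ap bp]; rewrite !(in_cons x) ap bp !orbT.
Qed.

Lemma sorted_arcs g p a b : sorted g p -> (a, b) \in arcs p -> g a b.
Proof.
elim: p => [|x [|y p] IH] //= /andP[gxy gp].
by rewrite /arcs /= inE => /predU1P[[-> ->] //|]; apply: IH.
Qed.

(** Simple paths in V have at most [size V] vertices, so that prolonging one as
long as possible ends. *)
Lemma maximal_path g (V : seq T) x :
  (forall a, reach g x a -> a \in V) ->
  exists p, [/\ path g x p, uniq (x :: p) &
                forall b, g (last x p) b -> b \in x :: p].
Proof.
move=> rV; suff H k p : size V <= size p + k -> path g x p -> uniq (x :: p) ->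
    exists p, [/\ path g x p, uniq (x :: p) & forall b, g (last x p) b -> b \in x :: p].
  by apply: (H (size V) [::]).
elim: k p => [|k IH] p le_V gp up.
  have := uniq_leq_size up (s2 := V).
  have sub : {subset x :: p <= V} by move=> y yp; apply/rV/(path_reach gp).
  by move/(_ sub); rewrite /= => lt; lia.
case: (pselect (exists2 b, g (last x p) b & b \notin x :: p)) => [[b gb bp]|nob].
  apply: (IH (rcons p b)); first by rewrite size_rcons addSnnS.
    by rewrite rcons_path gp.
  by rewrite -rcons_cons rcons_uniq bp.
exists p; split=> // b gb; apply/negPn/negP => bp.
by apply: nob; exists b.
Qed.

(** The only walk from x stops at a vertex without successors, and then c is
empty, or comes back to one of its own vertices, where the cycle c starts. *)
Lemma lasso g (V : seq T) x :
  (forall a, reach g x a -> a \in V) ->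
  (forall a b b', reach g x a -> g a b -> g a b' -> b = b') ->
  exists t c, [/\ path g x t, uniq (x :: t),
    c = [::] \/ (exists2 c', c = last x t :: c' & all (fun a =>
      a \notin c) (belast x t)),
    cycle g c /\ uniq c & [/\
    (forall a, a \in c -> reach g x a),
    (forall a, reach g x a -> (a \in x :: t) || (a \in c)) &
    forall a b, reach g x a -> g a b ->
      ((a, b) \in arcs (x :: t)) || ((a, b) \in arcs (closed_walk c))]].
Proof.
move=> rV det; have [p [gp up maxp]] := maximal_path rV.
have step a b : a \in x :: p -> g a b ->
    (a, b) \in arcs (x :: p) \/ a = last x p /\ b \in x :: p.
  move=> ap gab; have ra := path_reach gp ap.
  case/splitPr Ep: {1}(x :: p) / (ap) => [s1 [|b' s2]].
    have La : a = last x p by rewrite -[last x p]/(last x (x :: p)) Ep last_cat.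
    by right; split=> //; apply: maxp; rewrite -La.
  left; have ab' : (a, b') \in arcs (x :: p).
    by rewrite Ep arcs_cat mem_cat /arcs /= mem_head orbT.
  have gab' : g a b' by apply: (@sorted_arcs g (x :: p)).
  by rewrite -Ep (det a b b' ra gab gab').
have rp a : reach g x a -> a \in x :: p.
  case=> q gq <-; elim/last_ind: q gq => [|q b IH]; first by rewrite mem_head.
  rewrite rcons_path last_rcons => /andP[/IH qp gqb].
  have [|[_ //]] := step _ _ qp gqb.
  by case/arcs_mem/andP.
have bip a : a \in x :: p -> reach g x a := path_reach gp.
case: (pselect (exists b, g (last x p) b)) => [[b gb]|nob]; last first.
  exists p, [::]; split=> //; first by left.
  split=> // [a /rp -> //|a b /rp ap gab].
  have [-> //|[La _]] := step _ _ ap gab.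
  by case: nob; exists b; rewrite -La.
(* The arrow to b closes the cycle, which is the part of the path after b. *)
have bp := maxp b gb.
have [s1 [s2 E]] : exists s1 s2, x :: p = s1 ++ b :: s2.
  by case/splitPr: bp => s1 s2; exists s1, s2.
have [t Et] : exists t, rcons s1 b = x :: t.
  by case: (s1) E => [|y s] /= [-> _]; [exists [::] | exists (rcons s b)].
have lt : last x t = b by rewrite -[last x t]/(last x (x :: t)) -Et last_rcons.
have lp : last x p = last b s2 by rewrite -[last x p]/(last x (x :: p)) E last_cat.
have bt : belast x t = s1.
  by have := congr1 rev Et; rewrite lastI !rev_rcons lt => -[/(can_inj revK)].
have gE : sorted g (x :: p) := gp.
have gc : path g b s2.
  by move: gE; rewrite E -cat_rcons; case: (s1) => [|? ?] //=;
    rewrite cat_path last_rcons => /andP[].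
exists t, (b :: s2); split.
- by move: gE; rewrite E -cat_rcons Et /= cat_path => /andP[].
- by move: up; rewrite E -cat_rcons cat_uniq Et => /andP[].
- right; exists s2; first by rewrite lt.
  rewrite bt; move: up; rewrite E cat_uniq => /and3P[_ /hasPn d _].
  by apply/allP => a as1; apply/negP => /d; rewrite /= as1.
- split; first by rewrite /= rcons_path gc -lp.
  by move: up; rewrite E cat_uniq => /and3P[].
split.
- by move=> a ac; apply: bip; rewrite E mem_cat ac orbT.
- move=> a /rp; rewrite E -cat_rcons mem_cat Et => /orP[-> //|ac].
  by rewrite !in_cons ac !orbT.
move=> a b' /rp ap gab; have bc : closed_walk (b :: s2) = rcons (b :: s2) b.
  by rewrite /closed_walk /= take0 cats1.
rewrite bc arcs_rcons mem_rcons in_cons; have [|[La _]] := step a b' ap gab.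
  by rewrite E arcs_cat Et mem_cat => /orP[-> //|->]; rewrite !orbT.
have -> : b' = b by apply: det gab _; [apply: bip|rewrite La].
by rewrite La lp eqxx orbT.
Qed.

(** The numerical counterpart of [is_bicycle], for lists i, k and t of vertices of
the initial cycle, the connecting path and the terminal cycle. *)
Definition bicycle_shape g (i k t : seq T) : bool :=
  [&& cycle g i && uniq i, cycle g t && uniq t, all (fun a => a \notin t) i,
      [&& size k > 0, sorted g k & uniq k] &
      if k is x :: p then
        (nilp i || (x \in i) && all (fun a => a \notin i) p) &&
        (nilp t || (last x p \in t) && all (fun a => a \notin t) (belast x p))
      else false].

Definition bicycle_arc (i k t : seq T) a b : bool :=
  [|| (a, b) \in arcs (closed_walk i), (a, b) \in arcs k | (a,
    b) \in arcs (closed_walk t)].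

(** The graph consists of a walk with no choice of predecessor before v, the
one-way arrow from v to u, and a walk with no choice of successor after u. *)
Record gate g (V : pred T) v u : Prop := Gate {
  gate_edge : g v u;
  gate_back : ~ reach g u v;
  gate_pred : forall a b b', reach g a v -> g b a -> g b' a -> b = b';
  gate_succ : forall a b b', reach g u a -> g a b -> g a b' -> b = b';
  gate_vertices : forall a, V a -> reach g a v \/ reach g u a;
  gate_edges : forall a b, g a b -> [\/ reach g b v, a = v /\ b = u | reach g u a]
}.

Lemma reach_revE g x y : reach (fun a b => g b a) x y <-> reach g y x.
Proof. by split=> /reach_rev. Qed.

(** The lasso from v in the reversed graph and the lasso from u are disjoint,
since no vertex that reaches v is reached from u; joined by the arrow from v to u
they cover the graph. *)
Lemma gate_bicycle g (V : pred T) (s : seq T) v u :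
  {subset V <= s} -> (forall a b, g a b -> V a && V b) -> gate g V v u ->
  exists i k t, [/\ bicycle_shape g i k t, {subset i ++ k ++ t <= V},
    {subset V <= i ++ k ++ t} & forall a b, g a b -> bicycle_arc i k t a b].
Proof.
move=> Vs gV [gvu nuv dpred dsucc cv ce].
have [Vv Vu] : V v /\ V u by apply/andP/gV.
pose h := fun a b => g b a.
have rL a : reach h v a -> V a.
  by apply: reach_mem => // b b' /gV/andP[].
have rR a : reach g u a -> V a.
  by apply: reach_mem => // b b' /gV/andP[].
have [l [ci [hl ul li [hi ui] [ri vl el]]]] := @lasso h s v
  (fun a ra => Vs _ (rL a ra))
  (fun a b b' ra gab gab' => dpred a b b' (proj1 (reach_revE g v a) ra) gab gab').
have [r [ct [gr ur lt [gt ut] [rt vr er]]]] := @lasso g s u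
  (fun a ra => Vs _ (rR a ra)) dsucc.
have rl a : a \in v :: l -> reach h v a := path_reach hl.
have rr a : a \in u :: r -> reach g u a := path_reach gr.
have LR a : reach h v a -> reach g u a -> False.
  by move=> /reach_revE av ua; apply/nuv/(reach_trans ua).
(* Rotated so that the closed walk of i is the reverse of that of ci. *)
pose i := rotr 1 (rev ci).
have mi : i =i ci by move=> a; rewrite mem_rotr mem_rev.
have ai a b : ((a, b) \in arcs (closed_walk i)) = ((b, a) \in arcs (closed_walk ci)).
  rewrite -[RHS]arcs_rev /i; case: (ci) => // x c'.
  by rewrite rev_cons rotr1_rcons /closed_walk /= !take0 !cats1 rev_cons rev_rcons.
have [gi uni] : cycle g i /\ uniq i by rewrite rotr_uniq rev_uniq rotr_cycle rev_cycle.
have i0 : ci = [::] -> i = [::] by rewrite /i => ->.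
clearbody i; pose x := last v l; pose p := rev (belast v l) ++ u :: r.
have kE : rev (v :: l) ++ u :: r = x :: p by rewrite (lastI v l) rev_rcons.
have [bE xE] : belast x p = rev (v :: l) ++ belast u r /\ last x p = last u r.
  have : rcons (belast x p) (last x p) = rcons (rev (v :: l) ++ belast u r) (last u r).
    by rewrite -lastI rcons_cat -lastI kE.
  by move/rcons_inj => [-> ->].
have il a : a \in i -> reach h v a by rewrite mi; apply: ri.
exists i, (rev (v :: l) ++ u :: r), ct; split.
- apply/and5P; split.
  + by rewrite gi uni.
  + by rewrite gt ut.
  + by apply/allP => a /il av; apply/negP => /rt /LR; apply.
  + rewrite kE; apply/and3P; split=> //.
      rewrite /= cat_path rev_path hl /= gr andbT.
      by rewrite /x; case: (l) => //= y l'; rewrite rev_cons last_rcons.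
    rewrite -kE cat_uniq rev_uniq ul ur andbT; apply/hasPn => a ar; apply/negP.
    by rewrite mem_rev => /rl /LR; apply; apply: rr.
  rewrite kE xE bE; apply/andP; split.
    case: li => [ci0|[c' cE di]]; first by rewrite i0.
    apply/orP; right; rewrite mi cE mem_head /= all_cat all_rev; apply/andP; split.
      by apply: sub_all di => a; rewrite mi.
    by apply/allP => a ar; apply/negP => /il /LR; apply; apply: rr.
  case: lt => [-> //|[c' cE dt]]; apply/orP; right.
  rewrite {1}cE mem_head all_cat dt andbT all_rev.
  by apply/allP => a /rl av; apply/negP => /rt /LR; apply.
- move=> a; rewrite !mem_cat mem_rev => /or3P[/il av|/orP[/rl av|/rr ua]|/rt ua];
    by [apply: rL av | apply: rR ua].
- move=> a /cv[/reach_revE/vl|/vr]; rewrite !mem_cat mem_rev mi => /orP[] ->;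
    by rewrite ?orbT.
move=> a b gab; rewrite /bicycle_arc ai arcs_cat mem_cat -rev_cons arcs_rev.
have -> : arcs [:: u, v & l] = (u, v) :: arcs (v :: l) by [].
rewrite inE; case: (ce a b gab) => [/reach_revE/el/(_ gab)|[-> ->]|/er/(_ gab)].
- by case/orP => ->; rewrite ?orbT.
- by rewrite eqxx !orbT.
by case/orP => ->; rewrite ?orbT.
Qed.

(** A path whose end reaches v can be prolonged to u, and one whose start is
reached from u can be prolonged backwards to v.  Any other path passes from
vertices that reach v to vertices that do not, which only the gate allows. *)
Lemma gate_extend g (V : pred T) v u x p :
  gate g V v u -> V x -> all V p -> path g x p ->
  exists l r, sorted g (l ++ v :: u :: r) /\
    exists s1 s2, l ++ v :: u :: r = s1 ++ (x :: p) ++ s2.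
Proof.
move=> [gvu nuv _ _ cv ce] Vx Vp gp.
have Vy : V (last x p) by have /allP := (introT andP (conj Vx Vp) : all V (x :: p));
  apply; rewrite mem_last.
have [[w gw lw]|uy] := cv _ Vy.
  have [l lE] : exists l, x :: p ++ w = rcons l v.
    by exists (belast x (p ++ w)); rewrite lastI last_cat lw.
  exists l, [::]; rewrite -cat_rcons -lE; split.
    by rewrite /= -catA cat_path gp cat_path gw lw /= gvu.
  by exists [::], (w ++ [:: u]); rewrite /= -catA.
have [xv|[w gw lw]] := cv _ Vx; last first.
  exists [::], (w ++ p); split; first by rewrite /= gvu cat_path gw lw.
  by exists (v :: belast u w), [::]; rewrite /= cats0 -cat_rcons -lw -lastI.
suff [l [r E]] : exists l r, x :: p = l ++ v :: u :: r.
  by exists l, r; rewrite -E; split=> //; exists [::], [::]; rewrite cats0.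
elim: p x gp xv uy {Vx Vp Vy} => [|z p IH] x /=.
  by move=> _ xv ux; case: nuv; apply: reach_trans xv.
move=> /andP[gxz gp] xv uy; case: (ce x z gxz) => [zv|[-> ->]|ux].
- by have [l [r ->]] := IH z gp zv uy; exists (x :: l), r.
- by exists [::], p.
by case: nuv; apply: reach_trans xv.
Qed.

Lemma deterministic_join g x p q :
  (forall a b b', reach g x a -> g a b -> g a b' -> b = b') ->
  path g x p -> path g x q ->
  exists r, path g x r /\ exists p' q', r = p ++ p' /\ r = q ++ q'.
Proof.
move=> det gp gq; have [le|/ltnW le] := leqP (size p) (size q).
  exists q; split=> //; exists (drop (size p) q), [::].
  by rewrite {1}(deterministic_path det gp gq le) cat_take_drop cats0.
exists p; split=> //; exists [::], (drop (size q) p).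
by rewrite {1}(deterministic_path det gq gp le) cat_take_drop cats0.
Qed.

Lemma sorted_all g (V : pred T) p :
  (forall a b, g a b -> V a && V b) -> sorted g p -> 1 < size p -> all V p.
Proof.
move=> gV; case: p => [|x [|y p]] // gp _; apply/allP => z.
have Vx : V x by case/andP: gp => /gV/andP[].
by move/(path_reach gp); apply: reach_mem Vx => a b /gV/andP[].
Qed.

(** Prolonged through the gate, both paths run along the same two walks without
choices, so on either side of the gate one of them contains the other. *)
Lemma gate_common_path g (V : pred T) v u p q :
  gate g V v u -> p != [::] -> q != [::] -> all V p -> all V q ->
  sorted g p -> sorted g q ->
  exists r, [/\ sorted g r, 1 < size r & (exists s1 s2, r =
    s1 ++ p ++ s2) /\ (exists s1 s2, r = s1 ++ q ++ s2)].
Proof.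
move=> Hg; case: p q => [|x p] [|y q] // _ _ /andP[Vx Vp] /andP[Vy Vq] gp gq.
have [l1 [r1 [g1 [a1 [b1 E1]]]]] := gate_extend Hg Vx Vp gp.
have [l2 [r2 [g2 [a2 [b2 E2]]]]] := gate_extend Hg Vy Vq gq.
case: Hg => [gvu _ dpred dsucc _ _].
pose h a b := g b a.
have split_gate l r : sorted g (l ++ v :: u :: r) = [&& path h v (rev l),
  g v u & path g u r].
  rewrite sorted_cat_cons -[rcons l v]revK rev_rcons rev_sorted.
  by [].
move: g1 g2; rewrite !split_gate => /and3P[gl1 _ gr1] /and3P[gl2 _ gr2].
have [l [gl [l1' [l2' [lE1 lE2]]]]] := deterministic_join
  (fun a b b' ra gab gab' =>
    dpred a b b' (proj1 (reach_revE g v a) ra) gab gab') gl1 gl2.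
have [r [gr [r1' [r2' [rE1 rE2]]]]] := deterministic_join dsucc gr1 gr2.
exists (rev l ++ v :: u :: r); split.
- by rewrite split_gate revK gl gvu gr.
- by rewrite size_cat /= !addnS.
split; [exists (rev l1' ++ a1), (b1 ++ r1')|exists (rev l2' ++ a2), (b2 ++ r2')].
- by rewrite lE1 rE1 rev_cat revK -catA -!cat_cons (catA l1) E1 -!catA.
- by rewrite lE2 rE2 rev_cat revK -catA -!cat_cons (catA l2) E2 -!catA.
Qed.

End Digraph.

(** * Joint embedding and the factor graph *)

Section Structures.
Variable sg : seq nat.
Local Notation c := (code_structure sg).
Local Notation W k l s := (code_structure sg (window k l s)).

Lemma code_len s t : c s = c t -> len s = len t.
Proof. by move=> st; rewrite -(len_dec sg) st len_dec. Qed.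

Lemma code_window s t k l : c s = c t -> k + l <= len s -> W k l s = W k l t.
Proof.
move=> /eqP; rewrite -iso_code => /isoP[ls H] kl; apply/eqP; rewrite -iso_code.
apply/isoP; split=> //= i u lti; rewrite mem_tuples => /andP[su /allP ul].
apply: H => //; rewrite mem_tuples size_map su; apply/allP =>
  _ /mapP[x /ul /= xl ->] /=.
by apply: leq_trans kl; rewrite ltn_add2l.
Qed.

Lemma window_window k l k' l' s : W k l (window k' l' s) = W (k' + k) l s.
Proof.
apply/eqP; rewrite -iso_code; apply/isoP; split=> //= i u _ _.
by rewrite -map_comp; congr (holds _ _ _); apply: eq_map => x /=; rewrite addnA.
Qed.

Lemma window_full s : W 0 (len s) s = c s.
Proof.
apply/eqP; rewrite -iso_code; apply/isoP; split=> //= i u _ _.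
by congr (holds _ _ _); rewrite -[RHS]map_id; apply: eq_map.
Qed.

Lemma window_of_window k l k' s t :
  W k (len s) t = c s -> k' + l <= len s -> W k' l s = W (k + k') l t.
Proof. by move=> st kl; rewrite -(code_window st) //= window_window. Qed.

Lemma cleP s t : cle sg s t <-> exists2 k, k + len s <= len t & W k (len s) t = c s.
Proof.
split=> [[k [kl]]|[k kl E]].
  by rewrite iso_code => /eqP E; exists k.
by exists k; rewrite iso_code E.
Qed.

Lemma cle_window k l t : k + l <= len t -> cle sg (window k l t) t.
Proof. by move=> kl; apply/cleP; exists k. Qed.

Lemma cle_trans t s z : cle sg s t -> cle sg t z -> cle sg s z.
Proof.
move=> /cleP[k kl E] /cleP[k' kl' E']; apply/cleP; exists (k' + k); first by lia.
by rewrite -(window_of_window E').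
Qed.

Lemma cle_code s s' t t' : c s = c s' -> c t = c t' -> cle sg s t -> cle sg s' t'.
Proof.
move=> Es Et /cleP[k kl E]; apply/cleP; exists k.
  by rewrite -(code_len Es) -(code_len Et).
by rewrite -Es -E -(code_len Es); apply/esym/code_window.
Qed.

Lemma cle_refl s : cle sg s s.
Proof. by apply/cleP; exists 0; rewrite ?window_full. Qed.

Definition joint (C : structure -> Prop) : Prop :=
  forall s t, C s -> C t -> exists z, [/\ C z, cle sg s z & cle sg t z].

(** If s and t have no common upper bound in the class, then the members that are
not above s and those that are not above t cover it. *)
Lemma atomic_joint X B : atomic sg X (Av sg X B) <-> joint (Av sg X B).
Proof.
split=> [at_ s t Cs Ct|J [D [E [dD dE [DC [x [Cx nDx]]] [EC [y [Cy nEy]]] CDE]]]].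
  apply: contrapT => nz; apply: at_; pose C := Av sg X B.
  have down r : down_closed sg X (fun z => C z /\ ~ cle sg r z).
    move=> z z' Xz [[Xz' Bz'] nr] zz'; split.
      by split=> // b /Bz' nb bz; apply: nb; apply: cle_trans zz'.
    by move=> rz; apply: nr; apply: cle_trans zz'.
  exists (fun z => C z /\ ~ cle sg s z), (fun z => C z /\ ~ cle sg t z); split=> //.
  - by split=> [z []//|]; exists s; split=> // -[_]; apply; apply: cle_refl.
  - by split=> [z []//|]; exists t; split=> // -[_]; apply; apply: cle_refl.
  move=> z; split=> [Cz|[[]|[]] //].
  have [sz|] := pselect (cle sg s z); last by left.
  have [tz|] := pselect (cle sg t z); last by right.
  by case: nz; exists z.
have [z [Cz xz yz]] := J x y Cx Cy.
case: (proj1 (CDE z) Cz) => [Dz|Ez].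
  by apply: nDx; apply: dD Dz xz; case: Cx.
by apply: nEy; apply: dE Ez yz; case: Cy.
Qed.

Variable X : structure -> Prop.
Hypothesis X_type : is_type sg X.

Lemma X_code s t : X s -> c s = c t -> X t.
Proof. by case: X_type => _ _ H _ Xs /eqP; rewrite -iso_code; apply: H. Qed.

Variable B : seq structure.
Local Notation C := (Av sg X B).

Lemma Av_code s t : C s -> c s = c t -> C t.
Proof.
move=> [Xs Bs] st; split; first exact: X_code st.
by move=> b /Bs nb bt; apply: nb; apply: cle_code bt.
Qed.

Lemma Av_window t k l : C t -> 0 < l -> k + l <= len t -> C (window k l t).
Proof.
case: X_type => _ _ _ H [Xt Bt] l0 kl; split; first exact: H.
by move=> b /Bt nb bt; apply: nb; apply: cle_trans (cle_window kl).
Qed.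

Lemma Av_len s : C s -> 0 < len s.
Proof. by case: X_type => _ H _ _ [/H[]]. Qed.

Variable m : nat.
Hypothesis m_gt1 : 1 < m.
Hypothesis B_len : forall b, List.In b B -> len b <= m.
Hypothesis X_valid : valid sg X.

(** An occurrence of a member of B has length at most m, so it lies inside a
window of length m. *)
Lemma Av_local z : X z -> m <= len z ->
  (forall k, k + m <= len z -> C (window k m z)) -> C z.
Proof.
move=> Xz mz H; split=> // b Bb /cleP[k kb E].
(* The window of length m at j contains the occurrence at k. *)
have bm := B_len Bb; pose j := minn k (len z - m).
have jm : j + m <= len z by rewrite /j; lia.
have [_ /(_ b Bb)] := H j jm; apply; apply/cleP; exists (k - j) => /=.
  by rewrite /j; lia.
by rewrite window_window subnKC // /j; lia.
Qed.

(** The two parts share at least m - 1 points, so each window of length m of the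
combined structure lies inside one of them. *)
Lemma Av_combine s t x : C s -> C t -> m <= len s -> m <= len t ->
  m.-1 <= x -> x <= len s -> x <= len t -> W (len s - x) x s = W 0 x t ->
  exists z, [/\ C z, len z = len s + len t - x, W 0 (len s) z = c s &
                W (len s - x) (len t) z = c t].
Proof.
move=> Cs Ct ms mt mx xs xt E.
have [|z [Xz [lz]]] := X_valid (x := x) (proj1 Cs) (proj1 Ct).
  by split=> //; [lia | rewrite iso_code E].
rewrite !iso_code => /eqP zs /eqP zt; exists z; split=> //.
apply: Av_local => // [|k km]; first by lia.
have [ks|sk] := leqP (k + m) (len s).
  apply: (@Av_code (window k m s)).
    by apply: Av_window => //; apply: ltnW.
  by rewrite (window_of_window zs).
apply: (@Av_code (window (k - (len s - x)) m t)).
  by apply: Av_window => //; [apply: ltnW | lia].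
by rewrite (window_of_window zt) ?subnKC //; lia.
Qed.

(** The factor graph has structures up to isomorphism as its vertices; here they
are represented by their codes. *)
Definition is_vertex : pred nat :=
  fun N => `[< vertex C m (dec sg N) /\ c (dec sg N) = N >].
Local Notation V := is_vertex.

Definition arrow : rel nat :=
  fun N M => [&& V N, V M & edge sg m (dec sg N) (dec sg M)].
Local Notation g := arrow.

Lemma arrow_vertices a b : g a b -> V a && V b.
Proof. by case/and3P=> -> ->. Qed.

Lemma vertexP N : V N -> [/\ C (dec sg N), len (dec sg N) = m & c (dec sg N) = N].
Proof. by move/asboolP => [[? ?] ?]. Qed.

Lemma vertex_window s k : C s -> k + m <= len s -> V (W k m s).
Proof.
move=> Cs km; apply/asboolP; rewrite code_dec_code; split=> //.
split; last by rewrite len_dec.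
apply: (@Av_code (window k m s)); last by rewrite code_dec_code.
by apply: Av_window => //; apply: ltnW.
Qed.

Lemma edge_code s t : len s = m -> len t = m ->
  edge sg m s t = (W 1 m.-1 s == W 0 m.-1 t).
Proof. by move=> sm tm; rewrite /edge iso_code. Qed.

Lemma arrowE s t : V (c s) -> V (c t) -> g (c s) (c t) = (W 1 m.-1 s == W 0 m.-1 t).
Proof.
move=> Vs Vt; rewrite /arrow Vs Vt /=.
have [_ sm _] := vertexP Vs; have [_ tm _] := vertexP Vt.
rewrite edge_code // (code_window (code_dec_code sg s)) ?sm; last by lia.
by rewrite (code_window (code_dec_code sg t)) ?tm; lia.
Qed.

Lemma arrow_window s k : C s -> k.+1 + m <= len s -> g (W k m s) (W k.+1 m s).
Proof.
move=> Cs km; rewrite arrowE; [|apply: vertex_window => //;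
  lia|apply: vertex_window => //; lia].
by rewrite !window_window addn0 addn1.
Qed.

Lemma reach_window s i j : C s -> i <= j -> j + m <= len s ->
  reach g (W i m s) (W j m s).
Proof.
move=> Cs ij; rewrite -(subnKC ij); elim: (j - i) => [|k IH].
  by rewrite addn0 => _; apply: reach_refl.
rewrite addnS => km; apply: reach_trans (reach_edge (arrow_window Cs km)).
by apply: IH; lia.
Qed.

(** The path associated with s, as a sequence of codes. *)
Definition trail s := [seq W k m s | k <- iota 0 (len s - m).+1].

Arguments trail : simpl never.

Lemma size_trail s : size (trail s) = (len s - m).+1.
Proof. by rewrite size_map size_iota. Qed.

Lemma nth_trail s k : k <= len s - m -> nth 0 (trail s) k = W k m s.
Proof. by move=> ks; rewrite (nth_map 0) ?size_iota // nth_iota. Qed.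

Lemma head_trail s : head 0 (trail s) = W 0 m s.
Proof. by []. Qed.

Lemma last_trail s : last 0 (trail s) = W (len s - m) m s.
Proof. by rewrite -nth_last size_trail nth_trail. Qed.

Lemma trail_window s k l : m <= l -> k + l <= len s ->
  trail (window k l s) = take (l - m).+1 (drop k (trail s)).
Proof.
move=> ml kl; apply: (@eq_from_nth _ 0) => [|i].
  by rewrite size_trail size_takel // size_drop size_trail /=; lia.
rewrite size_trail => /= il; rewrite nth_take // nth_drop !nth_trail /=; try lia.
by rewrite window_window.
Qed.

Lemma trail_code s t : m <= len s -> c s = c t -> trail s = trail t.
Proof.
move=> ms st; rewrite /trail -(code_len st); apply/eq_in_map => k.
by rewrite mem_iota => /andP[_ km]; apply: code_window => //; lia.
Qed.

Lemma trail_sorted s : C s -> m <= len s -> sorted g (trail s).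
Proof.
move=> Cs ms; apply/(sortedP 0) => i; rewrite size_trail => il.
by rewrite !nth_trail; [apply: arrow_window => //; lia | lia..].
Qed.

Lemma trail_vertices s : C s -> m <= len s -> all V (trail s).
Proof.
move=> Cs ms; apply/allP => _ /mapP[k + ->]; rewrite mem_iota => /andP[_ km].
by apply: vertex_window => //; lia.
Qed.

Lemma trail_size_len s t : m <= len s -> m <= len t ->
  size (trail s) = size (trail t) -> len s = len t.
Proof. by rewrite !size_trail; lia. Qed.

(** Combines s and t over their common window of length m. *)
Lemma trail_join s t : C s -> C t -> m <= len s -> m <= len t ->
  last 0 (trail s) = head 0 (trail t) ->
  exists z, [/\ C z, m <= len z, trail z = trail s ++ behead (trail t),
                W 0 (len s) z = c s & W (len s - m) (len t) z = c t /\
                len s - m + len t <= len z].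
Proof.
move=> Cs Ct ms mt; rewrite head_trail last_trail => E.
have [z [Cz lz zs zt]] := Av_combine (x := m) Cs Ct ms mt (leq_pred m) ms mt E.
exists z; split=> //; [by lia| |by split=> //; lia].
apply: (@eq_from_nth _ 0) => [|i].
  by rewrite size_cat size_behead !size_trail; lia.
rewrite size_trail => il; rewrite nth_cat nth_behead size_trail.
case: ltnP => is_.
  by rewrite !nth_trail ?(window_of_window zs) //; lia.
rewrite !nth_trail; [|lia..].
by rewrite (window_of_window zt); [congr (W _ _ _); lia | lia].
Qed.

(** Two consecutive vertices overlap on m - 1 points; validity applies because
this number is positive, and the vertices of the path are added one by one. *)
Lemma trail_realize x p : V x -> path g x p ->
  exists s, [/\ C s, m <= len s & trail s = x :: p].
Proof.
elim: p x => [|y p IH] x Vx.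
  have [Cx xm cx] := vertexP Vx; exists (dec sg x); rewrite xm; split=> //.
  by rewrite /trail xm subnn /= -{1}xm window_full cx.
case/andP=> gxy gp; have /andP[_ Vy] := arrow_vertices gxy.
have [t [Ct mt tE]] := IH y Vy gp; have [Cx xm cx] := vertexP Vx.
have yE : y = W 0 m t by rewrite -head_trail tE.
have H := @Av_combine _ t m.-1 Cx Ct; rewrite xm in H.
have [|||z [Cz lz zx zt]] := H (leqnn m) mt (leqnn _); try lia.
  have -> : m - m.-1 = 1 by lia.
  move: gxy; rewrite -cx yE arrowE ?cx -?yE // => /eqP ->.
  by rewrite window_window.
exists z; split=> //; first by lia.
rewrite -tE; apply: (@eq_from_nth _ 0) => [|i].
  by rewrite -cat1s size_cat !size_trail /=; lia.
rewrite size_trail => il; rewrite nth_trail //; case: i il => [|i] il /=.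
  by rewrite zx.
rewrite nth_trail; last by lia.
by rewrite (window_of_window zt); [congr (W _ _ _); lia | lia].
Qed.

Definition short_below_vertices : Prop :=
  forall s, C s -> len s <= m -> exists2 w, V w & cle sg s (dec sg w).

(** This says that no path of the factor graph is ambiguous. *)
Definition determined_by_trails : Prop :=
  forall s t, C s -> C t -> m <= len s -> m <= len t -> trail s = trail t -> c s = c t.

Lemma joint_long : short_below_vertices ->
  (forall s t, C s -> C t -> m <= len s -> m <= len t ->
     exists z, [/\ C z, cle sg s z & cle sg t z]) ->
  joint C.
Proof.
move=> short J.
have long s : C s -> exists s', [/\ C s', m <= len s' & cle sg s s'].
  move=> Cs; have [le|/ltnW le] := leqP (len s) m; last first.
    by exists s; split=> //; apply: cle_refl.
  have [w /vertexP[Cw wm _] sw] := short s Cs le.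
  by exists (dec sg w); rewrite wm.
move=> s t /long[s' [Cs' ms ss']] /long[t' [Ct' mt tt']].
have [z [Cz sz tz]] := J s' t' Cs' Ct' ms mt.
by exists z; split=> //; [apply: cle_trans sz | apply: cle_trans tz].
Qed.

Lemma trail_head_last s : C s -> m <= len s ->
  V (head 0 (trail s)) /\ V (last 0 (trail s)).
Proof.
by move=> Cs ms; rewrite head_trail last_trail; split; apply: vertex_window => //; lia.
Qed.

(** A path from the end of the trail of s to the start of that of t is the trail
of a structure that connects s and t. *)
Lemma strongly_connected_joint :
  short_below_vertices -> (forall x y, V x -> V y -> reach g x y) -> joint C.
Proof.
move=> short conn; apply: joint_long => // s t Cs Ct ms mt.
have [_ Vx] := trail_head_last Cs ms; have [Vy _] := trail_head_last Ct mt.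
have [p gp lp] := conn _ _ Vx Vy.
have [r [Cr mr rE]] := trail_realize Vx gp.
have [|z [Cz mz zE zs _]] := trail_join Cs Cr ms mr; first by rewrite rE.
have [|z' [Cz' mz' _ zz' [zt zl]]] := trail_join Cz Ct mz mt.
  by rewrite zE rE /= last_cat lp.
exists z'; split=> //; apply/cleP; last by exists (len z - m).
have sz : len s <= len z by have := congr1 size zE; rewrite size_cat !size_trail; lia.
exists 0; first by lia.
by rewrite -zs (window_of_window zz').
Qed.

Lemma trail_factor z s s1 s2 : C z -> m <= len z -> m <= len s ->
  trail z = s1 ++ trail s ++ s2 ->
  size s1 + len s <= len z /\ trail (window (size s1) (len s) z) = trail s.
Proof.
move=> Cz mz ms zE; have kz : size s1 + len s <= len z.
  by have := congr1 size zE; rewrite !size_cat !size_trail; lia.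
by rewrite trail_window // zE drop_size_cat // -size_trail take_size_cat.
Qed.

(** The trails of s and t are factors of one path.  A structure that realises it
has windows with the same trails as s and t, so these windows are s and t. *)
Lemma gate_joint v u :
  short_below_vertices -> determined_by_trails -> gate g V v u -> joint C.
Proof.
move=> short det Hg; apply: joint_long => // s t Cs Ct ms mt.
have [||||||r [gr sr [[s1 [s2 sE]] [t1 [t2 tE]]]]] :=
  gate_common_path Hg (p := trail s) (q := trail t);
  do ?[exact: trail_vertices | exact: trail_sorted | by rewrite -size_eq0 size_trail].
have Vr := sorted_all arrow_vertices gr sr.
case: r gr sr sE tE Vr => [|x r] // gr _ sE tE /andP[Vx _].
have [z [Cz mz zE]] := trail_realize Vx gr.
have sub w w1 w2 : C w -> m <= len w -> x :: r = w1 ++ trail w ++ w2 -> cle sg w z.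
  rewrite -zE => Cw mw /trail_factor[] // kw E.
  apply/cleP; exists (size w1) => //; apply: det => //.
  by apply: Av_window => //; apply: Av_len.
by exists z; split=> //; [apply: sub sE | apply: sub tE].
Qed.

Section Necessity.
Hypothesis J : joint C.

Lemma joint_short x0 : V x0 -> short_below_vertices.
Proof.
move=> /vertexP[C0 m0 _] s Cs sm.
have [z [Cz /cleP[k ks E] /cleP[k0 zm _]]] := J Cs C0.
have mz : m <= len z by lia.
(* The window of length m at j contains the occurrence of s at k. *)
pose j := minn k (len z - m); have jz : j + m <= len z by rewrite /j; lia.
exists (W j m z); first exact: vertex_window.
apply: (@cle_code s _ (window j m z)) => //; first by rewrite code_dec_code.
apply/cleP; exists (k - j) => /=; first by rewrite /j; lia.
by rewrite window_window subnKC // /j; lia.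
Qed.

Lemma joint_comparable x y : V x -> V y -> reach g x y \/ reach g y x.
Proof.
move=> /vertexP[Cx xm xE] /vertexP[Cy ym yE].
have [z [Cz /cleP[i iz Ei] /cleP[j jz Ej]]] := J Cx Cy.
rewrite xm xE in iz Ei; rewrite ym yE in jz Ej.
have [ij|/ltnW ij] := leqP i j.
  by left; rewrite -Ei -Ej; apply: reach_window.
by right; rewrite -Ei -Ej; apply: reach_window.
Qed.

(** By comparability some path leads from y to x.  If each of its arrows could be
reversed, x would reach y. *)
Lemma irreversible_arrow x y : V x -> V y -> ~ reach g x y ->
  exists v u, g v u /\ ~ reach g u v.
Proof.
move=> Vx Vy nxy; case: (joint_comparable Vx Vy) => // -[p gp lp].
apply: contrapT => nvu; apply: nxy.
have rev_arrow a b : g a b -> reach g b a.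
  by move=> gab; apply: contrapT => nba; apply: nvu; exists a, b.
rewrite -lp; elim: p y gp {Vy lp} => [|z p IH] y /=; first by move=> _;
  apply: reach_refl.
by move=> /andP[gyz gp]; apply: reach_trans (IH z gp) (rev_arrow _ _ gyz).
Qed.

Section Gate.
Variables v u : nat.
Hypotheses (gvu : g v u) (nuv : ~ reach g u v).

Let Vv : V v. Proof. by case/andP: (arrow_vertices gvu). Qed.
Let Vu : V u. Proof. by case/andP: (arrow_vertices gvu). Qed.

Definition crosses s i : Prop :=
  [/\ i.+1 < size (trail s), nth 0 (trail s) i = v & nth 0 (trail s) i.+1 = u].

Lemma crosses_cat s l r : trail s = l ++ v :: u :: r -> crosses s (size l).
Proof.
move=> E; rewrite /crosses E; split.
- by rewrite size_cat /=; lia.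
- by rewrite nth_cat ltnn subnn.
by rewrite nth_cat ltnNge leqnSn subSnn.
Qed.

Lemma crosses_window s i : crosses s i -> m <= len s ->
  [/\ i.+1 + m <= len s, W i m s = v & W i.+1 m s = u].
Proof.
case; rewrite size_trail => il; rewrite !nth_trail; try lia.
by move=> vE uE ms; split=> //; lia.
Qed.

(** If the crossings of s and t were at different positions of z, then z would
give a walk from u back to v. *)
Lemma crosses_aligned s t i j : C s -> C t -> m <= len s -> m <= len t ->
  crosses s i -> crosses t j ->
  exists z a b, [/\ a + i = b + j, a + len s <= len z /\ W a (len s) z = c s &
                    b + len t <= len z /\ W b (len t) z = c t].
Proof.
move=> Cs Ct ms mt /crosses_window/(_ ms)[is_ vs us] /crosses_window/(_ mt)[jt vt ut].
have [z [Cz /cleP[a az Ea] /cleP[b bz Eb]]] := J Cs Ct.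
exists z, a, b; split=> //.
have below p q r w : W p (len q) z = c q -> r + m <= len q -> W r m q = w ->
    W (p + r) m z = w by move=> E rq <-; rewrite (window_of_window E).
case: (ltngtP (a + i) (b + j)) => // lt; case: nuv.
  rewrite -(below _ _ _ _ Ea is_ us) -(below _ _ _ _ Eb _ vt); last by lia.
  by apply: reach_window => //; lia.
rewrite -(below _ _ _ _ Eb jt ut) -(below _ _ _ _ Ea _ vs); last by lia.
by apply: reach_window => //; lia.
Qed.

Lemma crosses_unique s t i : C s -> C t -> m <= len s -> m <= len t ->
  size (trail s) = size (trail t) -> crosses s i -> crosses t i -> c s = c t.
Proof.
move=> Cs Ct ms mt /(trail_size_len ms mt) st si ti.
have [z [a [b [/addIn <- [_ Ea] [_ Eb]]]]] := crosses_aligned Cs Ct ms mt si ti.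
by rewrite -Ea st Eb.
Qed.

(** The structure s is placed in a common upper bound with a structure of trail
v -> u, and the position of s relative to that arrow is inspected. *)
Lemma trail_trichotomy s : C s -> m <= len s ->
  [\/ reach g (last 0 (trail s)) v, exists i, crosses s i |
    reach g u (head 0 (trail s))].
Proof.
move=> Cs ms; have [|w [Cw mw wE]] := @trail_realize v [:: u] Vv;
  first by rewrite /= gvu.
have wc : crosses w 0 by rewrite /crosses wE.
(* Here w has length m + 1, and a and b are the positions of s and w in z. *)
have [w0 vw uw] := crosses_window wc mw.
have [z [Cz /cleP[a az Ea] /cleP[b bz Eb]]] := J Cs Cw.
have vz : W b m z = v by rewrite -vw (window_of_window Eb) ?addn0 //; lia.
have uz : W b.+1 m z = u by rewrite -uw (window_of_window Eb) ?addn1 //; lia.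
rewrite head_trail last_trail !(window_of_window Ea); try lia.
have [le|lt] := leqP (a + (len s - m)) b.
  by apply: Or31; rewrite -vz; apply: reach_window => //; lia.
have [lt'|le'] := ltnP b (a + 0).
  by apply: Or33; rewrite -uz; apply: reach_window => //; lia.
apply: Or32; exists (b - a); rewrite /crosses size_trail !nth_trail; try lia.
split; first by lia.
  by rewrite -vz (window_of_window Ea); [congr (W _ _ _); lia | lia].
by rewrite -uz (window_of_window Ea); [congr (W _ _ _); lia | lia].
Qed.

(** Two predecessors of a vertex that reaches v start two structures of the same
length that cross the gate at the same position, and [crosses_unique] identifies
them; likewise for successors after u. *)
Lemma joint_gate : gate g V v u.
Proof.
split=> //.
- move=> a b b' [p gp lp] gba gb'a.
  have pathb d : g d a ->
    path g d (a :: rcons p u) by rewrite /= rcons_path gp lp gvu => ->.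
  have crossb d s : trail s = d :: a :: rcons p u -> crosses s (size p).+1.
    move=> sE; rewrite /crosses sE /= size_rcons; split=> //.
      by rewrite -rcons_cons nth_rcons /= ltnS leqnn (nth_last 0 (a :: p)).
    by rewrite nth_rcons ltnn eqxx.
  have /andP[Vb _] := arrow_vertices gba; have /andP[Vb' _] := arrow_vertices gb'a.
  have [s [Cs ms sE]] := trail_realize Vb (pathb b gba).
  have [t [Ct mt tE]] := trail_realize Vb' (pathb b' gb'a).
  have st : c s = c t.
    by apply: crosses_unique (crossb _ _ sE) (crossb _ _ tE); rewrite ?sE ?tE.
  by have := trail_code ms st; rewrite sE tE => -[].
- move=> a b b' [p gp lp] gab gab'.
  have pathb d : g a d -> path g v (u :: rcons p d) by rewrite /= gvu rcons_path gp lp.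
  have [s [Cs ms sE]] := trail_realize Vv (pathb b gab).
  have [t [Ct mt tE]] := trail_realize Vv (pathb b' gab').
  have crossb r d : trail r = v :: u :: rcons p d ->
    crosses r 0 by rewrite /crosses => ->.
  have st : c s = c t.
    apply: crosses_unique (crossb _ _ sE) (crossb _ _ tE); rewrite ?sE ?tE //=.
    by rewrite !size_rcons.
  by have := trail_code ms st; rewrite sE tE => -[/rcons_inj[]].
- move=> a Va; have [s [Cs ms sE]] := @trail_realize a [::] Va isT.
  have := trail_trichotomy Cs ms; rewrite sE /= => -[|[i]|]; [by left| |by right].
  by rewrite /crosses sE => -[].
move=> a b gab; have /andP[Va _] := arrow_vertices gab.
have [|s [Cs ms sE]] := @trail_realize a [:: b] Va; first by rewrite /= gab.
have := trail_trichotomy Cs ms; rewrite sE /= => -[|[i]|];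
  [by apply: Or31| |by apply: Or33].
by rewrite /crosses sE; case: i => [|i] [] //= _ -> ->; apply: Or32.
Qed.

(** Two structures with the same trail are prolonged by one and the same structure
until they cross the gate, where [crosses_unique] applies. *)
Lemma joint_determined : determined_by_trails.
Proof.
move=> s t Cs Ct ms mt st; have ls := trail_size_len ms mt (congr1 size st).
have [Vh Vl] := trail_head_last Cs ms.
have [[p gp lp]|[i si]|[p gp lp]] := trail_trichotomy Cs ms.
- have [|r [Cr mr rE]] := @trail_realize _ (rcons p u) Vl.
    by rewrite rcons_path gp lp gvu.
  have [|z [Cz mz zE zs _]] := trail_join Cs Cr ms mr; first by rewrite rE.
  have [|z' [Cz' mz' zE' zt _]] := trail_join Ct Cr mt mr; first by rewrite rE -st.
  have zz : trail z = trail z' by rewrite zE zE' st.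
  have [l lE] : exists l, trail s ++ p = rcons l v.
    case/lastP Ep: (trail s ++ p) => [|l y].
      by have := congr1 size Ep; rewrite size_cat size_trail.
    exists l; rewrite -lp.
    by move: (congr1 (last 0) Ep); rewrite last_cat last_rcons => ->.
  have cz q : trail q = trail z -> crosses q (size l).
    move=> qz; apply: (@crosses_cat q l [::]).
    by rewrite qz zE rE [behead _]/= -cats1 catA lE cat_rcons.
  have cE : c z = c z' by apply: crosses_unique (cz z _) (cz z' _); rewrite ?zz.
  rewrite -zs -zt -ls; apply: code_window => //.
  by have := congr1 size zE; rewrite size_cat !size_trail; lia.
- apply: crosses_unique (si) _ => //; first by rewrite st.
  by move: si; rewrite /crosses st.
have [|r [Cr mr rE]] := @trail_realize v (u :: p) Vv; first by rewrite /= gvu.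
have rs : last 0 (trail r) = head 0 (trail s) by rewrite rE.
have rt : last 0 (trail r) = head 0 (trail t) by rewrite -st.
have [z [Cz mz zE _ [zs zl]]] := trail_join Cr Cs mr ms rs.
have [z' [Cz' mz' zE' _ [zt zl']]] := trail_join Cr Ct mr mt rt.
have zz : trail z = trail z' by rewrite zE zE' st.
have cz q : trail q = trail z -> crosses q 0.
  by move=> qz; apply: (@crosses_cat q [::] (p ++ behead (trail s))); rewrite qz zE rE.
have cE : c z = c z' by apply: crosses_unique (cz z _) (cz z' _); rewrite ?zz.
by rewrite -zs -zt -ls; apply: code_window.
Qed.

End Gate.
End Necessity.
End Structures.

(** * Bounded formulas about lists and structures *)

Ltac computable_lists :=
  computable_by ltac:(first
    [ apply: computable_div | apply: computable_mod | apply: computable_head_decode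
    | apply: computable_nth | apply: computable_size | apply: computable_drop_code ]).

Lemma computable_mem n x a : computable n x -> computable n a ->
  computable n (fun v => x v \in decode (a v)).
Proof.
move=> Hx Ha; apply: (@computable_ext _ (fun v => has (fun y =>
  y == x v) (decode (a v)))).
  by move=> v _; rewrite has_pred1.
by apply: (computable_has_decode (P := fun y v => y == x v)); computable_lists.
Qed.

Lemma uniqE (s : seq nat) :
  uniq s = all (fun i => all (fun j => (nth 0 s i == nth 0 s j) ==> (i == j))
                             (iota 0 (size s))) (iota 0 (size s)).
Proof.
apply/(uniqP 0)/allP => [H i|H i j il jl E].
  rewrite mem_iota => /= il; apply/allP => j; rewrite mem_iota => /= jl.
  by apply/implyP => /eqP /H ->.
have := H i; rewrite mem_iota => /(_ il) /allP/(_ j).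
by rewrite mem_iota => /(_ jl) /implyP/(_ (introT eqP E)) /eqP.
Qed.

Lemma computable_uniq n a : computable n a -> computable n (fun v =>
  uniq (decode (a v))).
Proof.
move=> Ha; apply: computable_ext (fun v _ => congr1 nat_of_bool (esym (uniqE _))) _.
by computable_lists.
Qed.

Lemma arcsE (p : seq nat) a b :
  ((a, b) \in arcs p) =
  has (fun i => (nth 0 p i == a) && (nth 0 p i.+1 == b)) (iota 0 (size p).-1).
Proof.
have sE : size (arcs p) = (size p).-1 by rewrite size_zip size_behead;
  apply/minn_idPr/leq_pred.
apply/(nthP (0, 0))/hasP => [[i il E]|[i]].
  exists i; first by rewrite mem_iota -sE.
  by move: E; rewrite nth_zip_cond il nth_behead => -[-> ->]; rewrite !eqxx.
rewrite mem_iota -sE => /= il /andP[/eqP ia /eqP ib]; exists i => //.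
by rewrite nth_zip_cond il nth_behead ia ib.
Qed.

Lemma computable_arcs n p a b : computable n p -> computable n a -> computable n b ->
  computable n (fun v => (a v, b v) \in arcs (decode (p v))).
Proof.
move=> Hp Ha Hb; apply: computable_ext (fun v _ =>
  congr1 nat_of_bool (esym (arcsE _ _ _))) _.
by computable_lists.
Qed.

Lemma closure_arcsE (p : seq nat) a b :
  ((a, b) \in arcs (closed_walk p)) =
  (0 < size p) && ((a, b) \in arcs p) || [&& 0 < size p,
    a == nth 0 p (size p).-1 & b == nth 0 p 0].
Proof.
case: p => [|x p]; first by rewrite andFb.
have -> : closed_walk (x :: p) =
  rcons (x :: p) x by rewrite /closed_walk /= take0 cats1.
rewrite arcs_rcons mem_rcons inE xpair_eqE orbC.
by rewrite (nth_last 0 (x :: p)).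
Qed.

Lemma computable_closure_arcs n p a b : computable n p -> computable n a ->
  computable n b ->
  computable n (fun v => (a v, b v) \in arcs (closed_walk (decode (p v)))).
Proof.
move=> Hp Ha Hb; apply: computable_ext (fun v _ =>
  congr1 nat_of_bool (esym (closure_arcsE _ _ _))) _.
by computable_by ltac:(first [apply: computable_arcs | apply: computable_nth |
  apply: computable_size]).
Qed.

Lemma sortedE (e : rel nat) s :
  sorted e s = all (fun i => e (nth 0 s i) (nth 0 s i.+1)) (iota 0 (size s).-1).
Proof.
apply/(sortedP 0)/allP => H i.
  by rewrite mem_iota => /= il; apply: H; lia.
by move=> il; apply: H; rewrite mem_iota; lia.
Qed.

Lemma cycleE (e : rel nat) s :
  cycle e s = (size s == 0) || sorted e s && e (nth 0 s (size s).-1) (nth 0 s 0).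
Proof. by case: s => // x s; rewrite /= rcons_path (nth_last 0 (x :: s)). Qed.

Lemma all_belastE (P : pred nat) x p :
  all P (belast x p) = all (fun i => P (nth 0 (x :: p) i)) (iota 0 (size p)).
Proof.
have -> : belast x p = [seq nth 0 (x :: p) i | i <- iota 0 (size p)].
  by rewrite (map_nth_iota0 0 (s := x :: p)) // lastI -cats1 take_size_cat ?size_belast.
by rewrite all_map.
Qed.

(** Each entry x multiplies the code plus one by at most 2 ^ (x + 1). *)
Lemma code_bound s L E : size s <= L -> all (geq E) s ->
  CodeSeq.code s < 2 ^ (L * E.+1).
Proof.
move=> sL sE; suff H : CodeSeq.code s < 2 ^ (size s * E.+1).
  by apply: leq_trans H _; rewrite leq_exp2l // leq_mul.
elim: s sE {sL} => [|x s IH] //= /andP[xE /IH lt].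
apply: (@leq_trans (2 ^ x.+1 * (CodeSeq.code s).+1)).
  rewrite expnS -mul2n; set q := CodeSeq.code s; have : 0 < 2 ^ x by rewrite expn_gt0.
  by move: (2 ^ x) => y; nia.
by rewrite mulSn expnD leq_mul // leq_exp2l.
Qed.

Section Embeddings.
Variable sg : seq nat.
Local Notation ar := (nth 0 sg).

Lemma computable_offset n h i : computable n h -> computable n (fun v =>
  offset sg (h v) i).
Proof.
move=> Hh; elim: i => [|i IH]; first exact: computable_const.
apply: (@computable_ext _ (fun v => offset sg (h v) i + h v ^ ar i)) => [v _|].
  by rewrite /offset -(addn1 i) iotaD map_cat sumn_cat /= addn0.
by computable_lists.
Qed.

(** The rank, among the tuples of a longer structure, of a tuple of points of the
window that starts at k; the tuple itself is given by its rank j. *)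
Lemma computable_rank n k h l j a :
  computable n h -> computable n k -> computable n l -> computable n j ->
  computable n (fun v => rank (h v) (map (addn (k v)) (digits (l v) a (j v)))).
Proof.
move=> Hh Hk Hl; elim: a j => [|a IH] j Hj /=; first exact: computable_const.
apply: (@computable_ext _ (fun v => (k v + j v %/ l v ^ a) * h v ^ a +
    rank (h v) (map (addn (k v)) (digits (l v) a (j v %% l v ^ a))))) => [v _|].
  by rewrite size_map size_digits.
by computable_by ltac:(first [apply: IH | apply: computable_div |
  apply: computable_mod]).
Qed.

Lemma computable_holds n N k l j i a :
  computable n N -> computable n k -> computable n l -> computable n j ->
  computable n (fun v => holds (window (k v) (l v) (dec sg (N v))) i (digits (l v) a (j v))).
Proof.
move=> HN Hk Hl Hj; rewrite /window /dec /=.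
by computable_by ltac:(first [apply: computable_offset | apply: computable_rank |
   apply: computable_nth | apply: computable_head_decode]).
Qed.

(** The signature is fixed, so the quantifier over relations is a finite
conjunction and the one over tuples is bounded by a power of the length. *)
Lemma computable_iso_window n N M k k' l :
  computable n N -> computable n k -> computable n M -> computable n k' ->
    computable n l ->
  computable n (fun v => iso sg (window (k v) (l v) (dec sg (N v)))
                                (window (k' v) (l v) (dec sg (M v)))).
Proof.
move=> HN Hk HM Hk' Hl.
apply: (@computable_ext _ (fun v => all (fun i => all (fun j =>
   holds (window (k v) (l v) (dec sg (N v))) i (digits (l v) (ar i) j) ==
   holds (window (k' v) (l v) (dec sg (M v))) i (digits (l v) (ar i) j))
   (iota 0 (l v ^ ar i))) (iota 0 (size sg)))).
  move=> v _; rewrite /iso eqxx /=; congr nat_of_bool; apply: eq_all => i.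
  by rewrite tuplesE all_map.
apply: (@computable_all_const n _ _ (fun i v => all _ (iota 0 (l v ^ ar i)))) => i.
by computable_by ltac:(apply: computable_holds).
Qed.

Lemma computable_len n N : computable n N -> computable n (fun v => len (dec sg (N v))).
Proof. by move=> HN; apply: computable_head_decode. Qed.

Lemma computable_well_coded n N :
  computable n N -> computable n (fun v => well_coded sg (N v)).
Proof.
move=> HN; rewrite /well_coded /dec /=.
by computable_by ltac:(first [apply: computable_offset |
   apply: computable_nth | apply: computable_size | apply: computable_head_decode]).
Qed.

Definition cleb a b : bool :=
  has (fun k => (k + len (dec sg a) <= len (dec sg b)) &&
     iso sg (window 0 (len (dec sg a)) (dec sg a)) (window k (len (dec sg a)) (dec sg b)))
   (iota 0 (len (dec sg b)).+1).

Lemma clebP a b : cleb a b <-> cle sg (dec sg a) (dec sg b).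
Proof.
rewrite cleP; split=> [/hasP[k _ /andP[kl]]|[k kl E]].
  by rewrite iso_code => /eqP E; exists k => //; rewrite -E window_full.
apply/hasP; exists k; first by rewrite mem_iota; lia.
by rewrite kl iso_code window_full E /=.
Qed.

Lemma computable_cleb n a b :
  computable n a -> computable n b -> computable n (fun v => cleb (a v) (b v)).
Proof.
move=> Ha Hb; rewrite /cleb.
by computable_by ltac:(first [apply: computable_iso_window | apply: computable_len]).
Qed.

End Embeddings.

(** * The decision procedure *)

(** The program f is only known to halt on the arguments that satisfy c. *)
Lemma computable_oracle n (c : seq nat -> bool) f q (h : seq nat -> bool) :
  computable n (fun v => c v) -> computable n q ->
  (forall v, size v = n -> c v -> eval f [:: q v] (h v)) ->
  computable n (fun v => c v && h v).
Proof.
move=> Hc [r Hr] Hf.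
apply: (@computable_ext _ (fun v => if c v then nat_of_bool (h v) else 0)) => [v _|].
  by case: (c v).
apply: (@computable_guard _ c _ (Comp f [:: r])) => // v sv cv.
apply: (@eval_comp _ _ _ [:: q v]) => //; last exact: Hf.
by case=> // _; apply: Hr.
Qed.

Section Decision.
Variables (sg : seq nat) (X : structure -> Prop).
Hypotheses (X_type : is_type sg X) (X_valid : valid sg X).
Hypotheses (X_dec : type_decidable sg X) (amb_dec : bicycle_ambiguity_decidable sg X).
Local Notation c := (code_structure sg).
Local Notation dec := (dec sg).

Let sg_sig : is_signature sg. Proof. by case: X_type. Qed.

Definition in_type N : bool := well_coded sg N && `[< X (dec N) >].

Lemma computable_in_type n a : computable n a -> computable n (fun v => in_type (a v)).
Proof.
move=> Ha; have [f Hf] := X_dec.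
apply: (computable_oracle (q := a) (f := f)) => // [|v _ wa].
  exact: computable_well_coded.
have [yes no] := Hf _ (well_coded_structure wa).
rewrite (dec_wellK wa) in yes no.
by case: (asboolP (X (dec (a v)))).
Qed.

Lemma in_typeP N : in_type N -> X (dec N) /\ c (dec N) = N.
Proof. by case/andP=> wN /asboolP; split=> //; apply: dec_wellK. Qed.

Lemma in_type_code s : X s -> in_type (c s).
Proof.
move=> Xs; have ss : is_structure s by case: X_type => _ H _ _; apply: H.
rewrite /in_type (well_coded_code sg_sig ss); apply/asboolP.
by apply: (X_code X_type Xs); rewrite code_dec_code.
Qed.

Definition basis_of N0 := [seq dec b | b <- decode N0].
Definition valid_basis N0 : bool := all in_type (decode N0).

Lemma computable_valid_basis n a :
  computable n a -> computable n (fun v => valid_basis (a v)).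
Proof.
move=> Ha; apply: (computable_all_decode (P := fun x _ => in_type x)) => //.
by apply: computable_in_type; apply: computable_head; lift_variables.
Qed.

Section Fixed.
Variable N0 : nat.
Local Notation B := (basis_of N0).
(* A coded list exceeds its entries, and the code of a structure exceeds its
   length, so this dimension is large enough for the basis coded by N0. *)
Local Notation m := N0.+2.
Local Notation C := (Av sg X B).

Let dim_gt1 : 1 < m. Proof. by []. Qed.

Definition in_class N : bool := in_type N && all (fun b => ~~ cleb sg b N) (decode N0).
Definition vertexb N : bool := in_class N && (len (dec N) == m).
Definition arrowb N M : bool :=
  [&& vertexb N, vertexb M & iso sg (window 1 m.-1 (dec N)) (window 0 m.-1 (dec M))].

Lemma in_basis b : List.In b B <-> exists2 N, N \in decode N0 & b = dec N.
Proof.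
rewrite /basis_of; elim: (decode N0) => [|x s IH] /=; first by split=> [//|[]].
rewrite IH; split=> [[<-|[N Ns ->]]|[N]].
- by exists x; rewrite ?mem_head.
- by exists N; rewrite ?in_cons ?Ns ?orbT.
by rewrite in_cons => /predU1P[-> ->|Ns ->]; [left | right; exists N].
Qed.

Lemma in_classP N : in_class N <-> C (dec N) /\ c (dec N) = N.
Proof.
split=> [/andP[/in_typeP[XN cN] /allP bN]|[[XN bN] cN]].
  split=> //; split=> // _ /in_basis[b bs ->] /clebP.
  by apply/negP; apply: bN.
rewrite /in_class -{1}cN in_type_code //=; apply/allP => b bs; apply/negP => /clebP.
by apply: bN; apply/in_basis; exists b.
Qed.

Lemma in_class_code s : C s -> in_class (c s).
Proof.
move=> Cs; apply/in_classP; rewrite code_dec_code; split=> //.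
by apply: (Av_code X_type Cs); rewrite code_dec_code.
Qed.

Lemma vertexbE : vertexb =1 is_vertex sg X B m.
Proof.
move=> N; apply/andP/asboolP => [[/in_classP[CN cN] /eqP mN]|[[CN mN] cN]] //.
by split; [apply/in_classP | rewrite mN].
Qed.

Lemma arrowbE N M : arrowb N M = arrow sg X B m N M.
Proof. by rewrite /arrowb !vertexbE. Qed.

(** A structure of length n <= m is coded by a list of 1 + [offset n (size sg)]
numbers, each of which is at most m. *)
Definition code_limit := 2 ^ ((offset sg m (size sg)).+1 * m.+1).
(** A list of distinct vertices has at most [code_limit] entries. *)
Definition list_limit := 2 ^ (code_limit * code_limit.+1).

Lemma offset_mono n p i : 0 < n -> n <= p -> offset sg n i <= offset sg p i.
Proof.
move=> n0 np; rewrite /offset; elim: (iota 0 i) => //= k s IH; rewrite leq_add //.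
by case: (nth 0 sg k) => // a; rewrite leq_exp2r.
Qed.

Lemma in_class_limit N : in_class N -> len (dec N) <= m -> N < code_limit.
Proof.
case/andP=> /andP[/and4P[n0 /eqP sE /allP le1 _] _] _ Nm.
rewrite -[N]CodeSeq.decodeK; apply: code_bound; first by rewrite sE ltnS offset_mono.
apply/(all_nthP 0) => -[|i] il; first by rewrite nth0.
by apply: (@leq_trans 1) => //; have := le1 i.+1; rewrite mem_iota => /(_ il).
Qed.

Lemma vertex_limit N : vertexb N -> N < code_limit.
Proof. by case/andP=> CN /eqP Nm; apply: in_class_limit; rewrite ?Nm. Qed.

Lemma list_code_limit p : all vertexb p -> uniq p -> CodeSeq.code p < list_limit.
Proof.
move=> /allP Vp up; apply: code_bound; last first.
  by apply/allP => x /Vp /vertex_limit /ltnW.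
rewrite -(size_iota 0 code_limit); apply: uniq_leq_size => // x /Vp /vertex_limit.
by rewrite mem_iota.
Qed.

Lemma exists_below (P : pred nat) n :
  reflect (exists2 x, x < n & P x) (has P (iota 0 n)).
Proof.
by apply: (iffP hasP) => -[x]; rewrite ?mem_iota => xn Px; exists x; rewrite ?mem_iota.
Qed.

Lemma forall_below (P : pred nat) n :
  reflect (forall x, x < n -> P x) (all P (iota 0 n)).
Proof.
by apply: (iffP allP) => H x; have := H x; rewrite ?mem_iota.
Qed.

(** Simple paths suffice to reach a vertex, which bounds the search. *)
Definition reachb x y : bool :=
  has (fun p => [&& 0 < size (decode p), nth 0 (decode p) 0 == x,
    nth 0 (decode p) (size (decode p)).-1 == y & sorted arrowb (decode p)]) (iota 0 list_limit).

Lemma reachbP x y : vertexb x -> reflect (reach (arrow sg X B m) x y) (reachb x y).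
Proof.
move=> Vx; apply: (iffP idP) => [/hasP[p _ /and4P[]]|[p gp <-]].
  case: (decode p) => [|z q] //= _ /eqP-> /eqP <- gq; exists q.
    by rewrite -(eq_path arrowbE).
  by rewrite (nth_last 0 (x :: q)).
have [q gq uq sub] := shortenP gp.
have Vq : all vertexb (x :: q).
  apply/allP => y'; rewrite !vertexbE => /(path_reach gq).
  by apply: reach_mem => [a b /arrow_vertices/andP[]|] //; rewrite -vertexbE.
apply/exists_below; exists (CodeSeq.code (x :: q)); first exact: list_code_limit.
by rewrite CodeSeq.codeK (nth_last 0 (x :: q)) /= !eqxx (eq_path arrowbE).
Qed.

Definition gateb v u : bool :=
  [&& arrowb v u, ~~ reachb u v,
    all (fun a => all (fun b => all (fun b' =>
      [&& arrowb b a, arrowb b' a & reachb a v] ==> (b == b')) (iota 0 code_limit))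
      (iota 0 code_limit)) (iota 0 code_limit),
    all (fun a => all (fun b => all (fun b' =>
      [&& arrowb a b, arrowb a b' & reachb u a] ==> (b == b')) (iota 0 code_limit))
      (iota 0 code_limit)) (iota 0 code_limit) &
    all (fun a => vertexb a ==> reachb a v || reachb u a) (iota 0 code_limit) &&
    all (fun a => all (fun b => arrowb a b ==>
      [|| reachb b v, (a == v) && (b == u) | reachb u a]) (iota 0 code_limit))
      (iota 0 code_limit)].

Lemma arrowb_vertices a b : arrowb a b -> [/\ vertexb a, vertexb b,
  a < code_limit & b < code_limit].
Proof. by case/and3P=> Va Vb _; split=> //; apply: vertex_limit. Qed.

Lemma gatebP v u : reflect (gate (arrow sg X B m) (is_vertex sg X B m) v u) (gateb v u).
Proof.
apply: (iffP idP) => [/and5P[gvu nuv /forall_below dp /forall_below ds]|[]].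
  case/andP=> /forall_below cv /forall_below ce.
  have [Vv Vu _ _] := arrowb_vertices gvu.
  split=> [||a b b' av|a b b' ua|a|a b]; rewrite -?arrowbE -?vertexbE //.
  - by move/(reachbP _ Vu); apply/negP.
  - move=> ba b'a; have [Vb Va bl al] := arrowb_vertices ba.
    have [_ _ b'l _] := arrowb_vertices b'a.
    have /forall_below/(_ b bl)/forall_below/(_ b' b'l)/implyP H := dp a al.
    by apply/eqP/H; rewrite ba b'a; apply/reachbP.
  - move=> ba b'a; have [Va Vb al bl] := arrowb_vertices ba.
    have [_ _ _ b'l] := arrowb_vertices b'a.
    have /forall_below/(_ b bl)/forall_below/(_ b' b'l)/implyP H := ds a al.
    by apply/eqP/H; rewrite ba b'a; apply/reachbP.
  - move=> Va; have /implyP/(_ Va)/orP := cv a (vertex_limit Va).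
    by case=> /reachbP H; [left | right]; apply: H.
  move=> ab; have [Va Vb al bl] := arrowb_vertices ab.
  have /forall_below/(_ b bl)/implyP/(_ ab)/or3P := ce a al.
  case=> [/reachbP H|/andP[/eqP-> /eqP->]|/reachbP H]; first by apply: Or31; apply: H.
    by apply: Or32.
  by apply: Or33; apply: H.
rewrite -arrowbE => gvu nuv dp ds cv ce; have [Vv Vu _ _] := arrowb_vertices gvu.
apply/and5P; split=> //.
- by apply/negP => /(reachbP _ Vu).
- apply/forall_below => a _; apply/forall_below => b _; apply/forall_below => b' _.
  apply/implyP => /and3P[ba b'a]; have [_ Va _ _] := arrowb_vertices ba.
  by move/(reachbP _ Va) => av; apply/eqP/(dp a); rewrite -?arrowbE.
- apply/forall_below => a _; apply/forall_below => b _; apply/forall_below => b' _.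
  apply/implyP => /and3P[ba b'a]; have [Va _ _ _] := arrowb_vertices ba.
  by move/(reachbP _ Vu) => av; apply/eqP/(ds a); rewrite -?arrowbE.
apply/andP; split.
  apply/forall_below => a _; apply/implyP => Va; apply/orP.
  by have := cv a; rewrite -vertexbE => /(_ Va)[] H; [left | right]; apply/reachbP.
apply/forall_below => a _; apply/forall_below => b _; apply/implyP => ab.
have [Va Vb _ _] := arrowb_vertices ab.
have := ce a b; rewrite -arrowbE => /(_ ab)[H|[-> ->]|H]; rewrite ?eqxx ?orbT //.
  by apply/or3P; apply: Or31; apply/reachbP.
by apply/or3P; apply: Or33; apply/reachbP.
Qed.

Definition bicycleb (i k t : seq nat) : bool :=
  bicycle_shape arrowb i k t && all vertexb (i ++ k ++ t).

Definition spanningb (i k t : seq nat) : bool :=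
  all (fun a => vertexb a ==> (a \in i ++ k ++ t)) (iota 0 code_limit) &&
  all (fun a => all (fun b => arrowb a b ==> bicycle_arc i k t a b) (iota 0 code_limit))
      (iota 0 code_limit).

Definition decoded_bicycle (i k t : seq nat) : bicycle :=
  Bicycle (map dec i) (map dec k) (map dec t).

Lemma vertexb_dec a : vertexb a -> vertex C m (dec a) /\ c (dec a) = a.
Proof. by rewrite vertexbE => /asboolP. Qed.

Lemma on_dec p a : all vertexb p -> vertexb a -> on sg (map dec p) (dec a) = (a \in p).
Proof.
move=> /allP Vp Va; rewrite /on has_map -has_pred1; apply: eq_in_has => b /Vp Vb /=.
by rewrite iso_code (proj2 (vertexb_dec Va)) (proj2 (vertexb_dec Vb)) eq_sym.
Qed.

Lemma distinct_dec p : all vertexb p -> uniq p -> distinct sg (map dec p).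
Proof.
move=> Vp; rewrite uniq_pairwise /distinct pairwise_map.
apply: (@sub_in_pairwise _ vertexb) Vp => a b Va Vb /=.
by rewrite iso_code (proj2 (vertexb_dec Va)) (proj2 (vertexb_dec Vb)).
Qed.

Lemma disjoint_dec p q : all vertexb p -> all vertexb q ->
  all (fun a => a \notin q) p -> disjoint_from sg (map dec p) (map dec q).
Proof.
move=> Vp Vq /allP pq; rewrite /disjoint_from all_map; apply/allP => a ap /=.
by rewrite on_dec // ?pq //; apply: (allP Vp).
Qed.

Lemma arrow_edge : subrel arrowb (relpre dec (edge sg m)).
Proof. by move=> a b /and3P[]. Qed.

Lemma decoded_bicycleP i k t : bicycleb i k t ->
  is_bicycle sg C m (decoded_bicycle i k t).
Proof.
case/andP=> /and5P[/andP[gi ui] /andP[gt ut] it /and3P[k0 gk uk]].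
rewrite !all_cat => att /and3P[Vi Vk Vt]; split.
  rewrite /bicycle_vertices /= -!map_cat => s.
  have : all vertexb (i ++ k ++ t) by rewrite !all_cat Vi Vk Vt.
  elim: (i ++ k ++ t) => //= a p IH /andP[Va Vp] [<-|]; last exact: IH.
  by case: (vertexb_dec Va).
have cyc p : cycle arrowb p -> all vertexb p -> uniq p -> simple_cycle sg m (map dec p).
  move=> gp Vp up; rewrite /simple_cycle distinct_dec // andbT cycle_map.
  by apply: sub_cycle gp; apply: arrow_edge.
apply/and5P; split; rewrite /= ?cyc ?disjoint_dec //.
  rewrite /simple_path size_map k0 distinct_dec // andbT /= sorted_map.
  by apply: sub_sorted gk; apply: arrow_edge.
case: k att Vk {k0 gk uk} => [|x p] // /andP[ai at_] /= /andP[Vx Vp].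
rewrite /attached /=; apply/andP; split.
  case/orP: ai => [/nilP -> //|/andP[xi pi]].
  by rewrite on_dec // xi disjoint_dec ?orbT.
case/orP: at_ => [/nilP -> //|/andP[xt pt]].
have Vl : all vertexb (rcons (belast x p) (last x p)) by rewrite -lastI /= Vx.
move: Vl; rewrite all_rcons => /andP[Vl Vb].
by rewrite last_map on_dec // xt belast_map disjoint_dec ?orbT.
Qed.

Lemma consecutive_dec p a b : (a, b) \in arcs p ->
  consecutive sg (map dec p) (dec a) (dec b).
Proof.
move=> ab; have zE (q r : seq nat) :
    zip (map dec q) (map dec r) = [seq (dec e.1, dec e.2) | e <- zip q r].
  by elim: q r => [|x q IH] [|y r] //=; rewrite IH.
rewrite /consecutive behead_map zE has_map; apply/hasP; exists (a, b) => //=.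
by rewrite !iso_code !eqxx.
Qed.

Lemma bicycle_edge_dec i k t a b : bicycle_arc i k t a b ->
  bicycle_edge sg (decoded_bicycle i k t) (dec a) (dec b).
Proof.
have cl p : close (map dec p) = map dec (closed_walk p) by rewrite map_cat map_take.
case/or3P=> /consecutive_dec H; apply/or3P; rewrite /= ?cl.
- by apply: Or31.
- by apply: Or32.
by apply: Or33.
Qed.

Lemma len_dec_le N : len (dec N) <= N.
Proof.
rewrite /dec /=; have := CodeSeq.gtn_decode N.
by case: (decode N) => //= x p /andP[/ltnW].
Qed.

Lemma basis_len b : List.In b B -> len b <= m.
Proof.
case/in_basis=> N /(allP (CodeSeq.gtn_decode N0)) NN0 ->.
by apply: leq_trans (len_dec_le N) _; apply: leq_trans (ltnW NN0) _;
  rewrite ltnW // ltnW.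
Qed.

Lemma max_length_basis : max_length B <= m.
Proof.
rewrite /max_length /basis_of big_map big_seq.
apply: (big_ind (fun x => x <= m)) => // [x y xm ym|N Ns]; first by rewrite geq_max xm.
by apply: basis_len; apply/in_basis; exists N.
Qed.

Lemma code_structures_dec p : {in p, forall a, c (dec a) = a} ->
  code_structures sg (map dec p) = CodeSeq.code p.
Proof.
move=> H; rewrite /code_structures -map_comp; congr CodeSeq.code.
by rewrite -[RHS]map_id; apply/eq_in_map.
Qed.

Definition instance i k t := BicycleInstance B m (decoded_bicycle i k t).

Lemma code_instance i k t : valid_basis N0 -> bicycleb i k t ->
  code_bicycle_instance sg (instance i k t) =
  CodeSeq.code [:: N0; m; CodeSeq.code i; CodeSeq.code k; CodeSeq.code t].
Proof.
move=> /allP vB /andP[_]; rewrite !all_cat => /and3P[Vi Vk Vt].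
have cV p : all vertexb p -> code_structures sg (map dec p) = CodeSeq.code p.
  by move=> /allP Vp; apply: code_structures_dec => a /Vp /vertexb_dec[].
rewrite /code_bicycle_instance /= (cV _ Vi) (cV _ Vk) (cV _ Vt) code_structures_dec ?CodeSeq.decodeK //.
by move=> a /vB /in_typeP[].
Qed.

Lemma all_in_basis : valid_basis N0 -> all_in X B.
Proof. by move=> /allP vB b /in_basis[N /vB /in_typeP[XN _] ->]. Qed.

Lemma trailE s : trail sg m s = map c (Pi_path m s).
Proof. by rewrite -map_comp. Qed.

(** An ambiguous path is the trail of two structures that are not isomorphic. *)
Lemma determined_unambiguous b :
  determined_by_trails sg X B m -> ~ contains_ambiguous_path sg C m b.
Proof.
move=> det [p [_ [s [t [[Cs ms sp] [Ct mt tp] /negP]]]]]; apply.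
have trailP r : all2 (iso sg) (Pi_path m r) p -> trail sg m r = map c p.
  rewrite trailE; move: (Pi_path m r) => q.
  elim: q p {sp tp} => [|x q IH] [|y p] //= /andP[+ /IH ->].
  by rewrite iso_code => /eqP ->.
by rewrite iso_code; apply/eqP/det; rewrite ?(trailP _ sp) ?(trailP _ tp).
Qed.

(** The bicycle has all the arrows of the factor graph, hence it contains every
trail; two different structures with the same trail would make it ambiguous. *)
Lemma spanning_determined i k t : bicycleb i k t -> spanningb i k t ->
  ~ contains_ambiguous_path sg C m (decoded_bicycle i k t) ->
  determined_by_trails sg X B m.
Proof.
move=> /andP[_ Vb] /andP[/forall_below cv /forall_below ce] na s u Cs Cu ms mu su.
have Vs : all vertexb (trail sg m s).
  by rewrite (eq_all vertexbE); apply: trail_vertices.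
apply: contrapT => nE; apply: na; exists (map dec (trail sg m s)); split.
  apply/and3P; split; first by rewrite size_map size_trail.
    rewrite all_map; apply/allP => a /(allP Vs) Va /=.
    rewrite /bicycle_vertices /= -!map_cat on_dec //.
    by have /implyP := cv a (vertex_limit Va); apply.
  rewrite sorted_map; have := trail_sorted X_type (B := B) (m := m) dim_gt1 Cs ms.
  apply: sub_sorted => a b /=; rewrite -arrowbE => ab; apply: bicycle_edge_dec.
  have [_ _ al bl] := arrowb_vertices ab.
  by have /forall_below/(_ b bl)/implyP := ce a al; apply.
have Pi r : trail sg m s = trail sg m r ->
    all2 (iso sg) (Pi_path m r) (map dec (trail sg m s)).
  move=> ->; rewrite trailE; move: (Pi_path m r) => q.
  by elim: q => //= x q ->; rewrite iso_code code_dec_code eqxx.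
exists s, u; split; [by split=> //; apply: Pi|by split=> //; apply: Pi|].
by rewrite iso_code; apply/eqP.
Qed.

Definition memberb N : bool := in_class N && (len (dec N) <= m).

Lemma memberb_code s : C s -> len s <= m -> memberb (c s).
Proof. by move=> Cs sm; rewrite /memberb in_class_code // len_dec. Qed.

Lemma memberb_limit N : memberb N -> N < code_limit.
Proof. by case/andP; apply: in_class_limit. Qed.

Definition small_jointb : bool :=
  all (fun x => all (fun y => memberb x && memberb y ==>
    has (fun z => [&& memberb z, cleb sg x z & cleb sg y z]) (iota 0 code_limit))
    (iota 0 code_limit)) (iota 0 code_limit).

Definition short_belowb : bool :=
  all (fun x => memberb x ==> has (fun w => vertexb w &&
    cleb sg x w) (iota 0 code_limit))
      (iota 0 code_limit).

Definition connectedb : bool :=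
  all (fun x => all (fun y => vertexb x && vertexb y ==>
    reachb x y) (iota 0 code_limit))
      (iota 0 code_limit).

Definition ambiguousb i k t : bool :=
  (valid_basis N0 && bicycleb i k t) &&
  `[< contains_ambiguous_path sg C m (decoded_bicycle i k t) >].

Definition bicycle_foundb : bool :=
  has (fun i => has (fun k => has (fun t =>
    [&& bicycleb (decode i) (decode k) (decode t),
        spanningb (decode i) (decode k) (decode t) &
        ~~ ambiguousb (decode i) (decode k) (decode t)])
    (iota 0 list_limit)) (iota 0 list_limit)) (iota 0 list_limit).

Definition gate_foundb : bool :=
  has (fun v => has (fun u => gateb v u) (iota 0 code_limit)) (iota 0 code_limit).

(** The first alternative is for classes without members of length m, which are
finite up to isomorphism.  In the last one the gate alone allows common paths to
be found; the bicycle serves to ask whether paths are ambiguous. *)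
Definition jointb : bool :=
  (~~ has vertexb (iota 0 code_limit)) && small_jointb ||
  short_belowb && (connectedb || gate_foundb && bicycle_foundb).

Lemma short_belowbP : reflect (short_below_vertices sg X B m) short_belowb.
Proof.
apply: (iffP (forall_below _ _)) => [H s Cs sm|H x _].
  have Ms := memberb_code Cs sm.
  have /implyP/(_ Ms)/exists_below[w _ /andP[Vw /clebP sw]] := H _ (memberb_limit Ms).
  exists w; first by rewrite -vertexbE.
  by apply: cle_code sw; rewrite ?code_dec_code.
apply/implyP => /andP[/in_classP[Cx cx] xm]; have [w Vw xw] := H _ Cx xm.
rewrite -vertexbE in Vw; apply/exists_below; exists w; first exact: vertex_limit.
by rewrite Vw; apply/clebP.
Qed.

Lemma connectedbP :
  reflect (forall x y, is_vertex sg X B m x -> is_vertex sg X B m y ->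
             reach (arrow sg X B m) x y) connectedb.
Proof.
apply: (iffP (forall_below _ _)) => [H x y|H x _].
  rewrite -!vertexbE => Vx Vy.
  have /forall_below/(_ y (vertex_limit Vy)) := H x (vertex_limit Vx).
  by rewrite Vx Vy => /(reachbP _ Vx).
apply/forall_below => y _; apply/implyP => /andP[Vx Vy].
by apply/(reachbP _ Vx)/H; rewrite -vertexbE.
Qed.

Lemma small_jointP : ~~ has vertexb (iota 0 code_limit) ->
  reflect (joint sg C) small_jointb.
Proof.
move=> nV; have small s : C s -> memberb (c s).
  move=> Cs; apply: memberb_code => //; rewrite leqNgt; apply/negP => ms.
  have Vs : vertexb (c (window 0 m s)).
    by rewrite vertexbE; apply: vertex_window => //; apply: ltnW.
  by case/negP: nV; apply/exists_below; exists (c (window 0 m s));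
    first exact: vertex_limit.
apply: (iffP (forall_below _ _)) => [H s t /small Ms /small Mt|J x _].
  have /forall_below/(_ _ (memberb_limit Mt)) := H _ (memberb_limit Ms).
  rewrite Ms Mt => /exists_below[z _ /and3P[/andP[/in_classP[Cz _] _] /clebP sz /clebP tz]].
  by exists (dec z); split=> //; [apply: cle_code sz | apply: cle_code tz];
    rewrite ?code_dec_code.
apply/forall_below => y _; apply/implyP.
case/andP=> /andP[/in_classP[Cx _] _] /andP[/in_classP[Cy _] _].
have [z [Cz xz yz]] := J _ _ Cx Cy; have Mz := small z Cz.
apply/exists_below; exists (c z); first exact: memberb_limit.
rewrite Mz; apply/and3P; split=> //; apply/clebP; [apply: cle_code xz |
  apply: cle_code yz];
  by rewrite ?code_dec_code.
Qed.

Lemma jointbP : valid_basis N0 -> reflect (joint sg C) jointb.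
Proof.
move=> vB; apply: (iffP orP) => [[/andP[nV]|/andP[/short_belowbP short]]|J].
- by move/(small_jointP nV).
- case/orP=> [/connectedbP conn|/andP[]].
    exact: (strongly_connected_joint X_type dim_gt1 basis_len X_valid short conn).
  case/exists_below=> v _ /exists_below[u _ /gatebP Hg].
  case/exists_below=> i _ /exists_below[k _ /exists_below[t _ /and3P[bb sb]]].
  rewrite /ambiguousb vB bb => /asboolP na.
  apply: (gate_joint X_type dim_gt1 basis_len X_valid short _ Hg).
  exact: spanning_determined bb sb na.
have [V0|nV] := boolP (has vertexb (iota 0 code_limit)); last first.
  by left; apply/(small_jointP nV).
have [x0 _ Vx0] := exists_below _ _ V0; rewrite vertexbE in Vx0.
right; apply/andP; split;
  first by apply/short_belowbP/(joint_short X_type dim_gt1 J Vx0).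
have [|nconn] := boolP connectedb => //=.
have [x [y [Vx Vy nxy]]] : exists x y, [/\ is_vertex sg X B m x, is_vertex sg X B m y &
    ~ reach (arrow sg X B m) x y].
  apply: contrapT => no; case/negP: nconn; apply/connectedbP => x y Vx Vy.
  by apply: contrapT => nxy; apply: no; exists x, y.
have [v [u [gvu nuv]]] := irreversible_arrow X_type dim_gt1 J Vx Vy nxy.
have Hg := joint_gate X_type dim_gt1 basis_len X_valid J gvu nuv.
have det := joint_determined X_type dim_gt1 basis_len X_valid J gvu nuv.
have Vlim : {subset is_vertex sg X B m <= iota 0 code_limit}.
  by move=> a Va; rewrite mem_iota /= add0n vertex_limit // vertexbE.
have [i [k [t [shape sub sup arcs_]]]] := gate_bicycle Vlim (@arrow_vertices _ _ _ _) Hg.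
have gE : arrowb =2 arrow sg X B m by move=> a b; apply: arrowbE.
apply/andP; split.
  have [Vv Vu vl ul] : [/\ vertexb v, vertexb u, v < code_limit & u < code_limit].
    by apply: arrowb_vertices; rewrite gE.
  by apply/exists_below; exists v => //; apply/exists_below; exists u => //;
    apply/gatebP.
have Vall : all vertexb (i ++ k ++ t) by apply/allP => a /sub; rewrite vertexbE.
have bb : bicycleb i k t.
  rewrite /bicycleb Vall andbT; move: shape; rewrite /bicycle_shape.
  by rewrite !(eq_cycle gE) (eq_sorted gE).
have sb : spanningb i k t.
  apply/andP; split; apply/forall_below => a _; last apply/forall_below => b _.
    by apply/implyP; rewrite vertexbE; apply: sup.
  by apply/implyP; rewrite gE; apply: arcs_.
have nb : ~~ ambiguousb i k t.
  by apply/negP => /andP[_ /asboolP]; apply: determined_unambiguous.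
move: Vall; rewrite !all_cat => /and3P[Vi Vk Vt].
case/andP: (bb) => /and5P[/andP[_ ui] /andP[_ ut] _ /and3P[_ _ uk] _] _.
apply/exists_below; exists (CodeSeq.code i); first exact: list_code_limit.
apply/exists_below; exists (CodeSeq.code k); first exact: list_code_limit.
apply/exists_below; exists (CodeSeq.code t); first exact: list_code_limit.
by rewrite !CodeSeq.codeK bb sb nb.
Qed.

End Fixed.

Ltac computable_codes tac :=
  computable_by ltac:(first
    [ tac | apply: computable_nth | apply: computable_size | apply: computable_len
    | apply: computable_cleb | apply: computable_iso_window
    | apply: computable_mem | apply: computable_uniq | apply: computable_arcs
    | apply: computable_closure_arcs | apply: computable_offset ]).

Lemma computable_in_class n a N :
  computable n a -> computable n N -> computable n (fun v => in_class (a v) (N v)).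
Proof.
move=> Ha HN; apply: computable_and; first exact: computable_in_type.
by apply: (computable_all_decode (P := fun b v => ~~ cleb sg b (N v))) => //;
  computable_codes fail.
Qed.

Lemma computable_vertexb n a N :
  computable n a -> computable n N -> computable n (fun v => vertexb (a v) (N v)).
Proof.
move=> Ha HN; rewrite /vertexb; computable_codes ltac:(apply: computable_in_class).
Qed.

Lemma computable_memberb n a N :
  computable n a -> computable n N -> computable n (fun v => memberb (a v) (N v)).
Proof.
move=> Ha HN; rewrite /memberb; computable_codes ltac:(apply: computable_in_class).
Qed.

Lemma computable_arrowb n a x y :
  computable n a -> computable n x -> computable n y ->
  computable n (fun v => arrowb (a v) (x v) (y v)).
Proof.
move=> Ha Hx Hy; rewrite /arrowb; computable_codes ltac:(apply: computable_vertexb).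
Qed.

Lemma computable_code_limit n a :
  computable n a -> computable n (fun v => code_limit (a v)).
Proof. by move=> Ha; rewrite /code_limit; computable_codes fail. Qed.

Lemma computable_list_limit n a :
  computable n a -> computable n (fun v => list_limit (a v)).
Proof. by move=> Ha; rewrite /list_limit;
  computable_codes ltac:(apply: computable_code_limit). Qed.

Lemma computable_sorted n a p : computable n a -> computable n p ->
  computable n (fun v => sorted (arrowb (a v)) (decode (p v))).
Proof.
move=> Ha Hp; apply: computable_ext (fun v _ =>
  congr1 nat_of_bool (esym (sortedE _ _))) _.
by computable_codes ltac:(apply: computable_arrowb).
Qed.

Lemma computable_cycle n a p : computable n a -> computable n p ->
  computable n (fun v => cycle (arrowb (a v)) (decode (p v))).
Proof.
move=> Ha Hp; apply: computable_ext (fun v _ =>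
  congr1 nat_of_bool (esym (cycleE _ _))) _.
by computable_codes ltac:(first [apply: computable_arrowb | apply: computable_sorted]).
Qed.

Lemma computable_reachb n a x y :
  computable n a -> computable n x -> computable n y ->
  computable n (fun v => reachb (a v) (x v) (y v)).
Proof.
move=> Ha Hx Hy; rewrite /reachb.
by computable_codes ltac:(first [apply: computable_sorted |
  apply: computable_list_limit]).
Qed.

Lemma computable_gateb n a x y :
  computable n a -> computable n x -> computable n y ->
  computable n (fun v => gateb (a v) (x v) (y v)).
Proof.
move=> Ha Hx Hy; rewrite /gateb.
by computable_codes ltac:(first [apply: computable_reachb | apply: computable_code_limit
  | apply: computable_vertexb | apply: computable_arrowb]).
Qed.

Lemma computable_all_vertexb n a p : computable n a -> computable n p ->
  computable n (fun v => all (vertexb (a v)) (decode (p v))).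
Proof.
move=> Ha Hp; apply: (computable_all_decode (P := fun x v => vertexb (a v) x)) => //.
by computable_codes ltac:(apply: computable_vertexb).
Qed.

Lemma computable_notin n p q : computable n p -> computable n q ->
  computable n (fun v => all (fun x => x \notin decode (q v)) (decode (p v))).
Proof.
move=> Hp Hq; apply: (computable_all_decode (P := fun x v =>
  x \notin decode (q v))) => //.
by computable_codes fail.
Qed.

(** The attachment condition is stated by cases on the connecting path;
positions in the list make it a bounded formula. *)
Lemma bicycle_shapeE (g : rel nat) i k t : bicycle_shape g i k t =
  [&& cycle g i && uniq i, cycle g t && uniq t, all (fun a => a \notin t) i,
      [&& size k > 0, sorted g k & uniq k] &
      ((size i == 0) || (nth 0 k 0 \in i) &&
         all (fun j => nth 0 k j.+1 \notin i) (iota 0 (size k).-1)) &&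
      ((size t == 0) || (nth 0 k (size k).-1 \in t) &&
         all (fun j => nth 0 k j \notin t) (iota 0 (size k).-1))].
Proof.
rewrite /bicycle_shape; case: k => [|x p]; first by rewrite !andbF.
have -> : all (fun j => nth 0 (x :: p) j.+1 \notin i) (iota 0 (size (x :: p)).-1) =
    all (fun a => a \notin i) p.
  by rewrite -[in RHS](mkseq_nth 0 p) /mkseq all_map.
by rewrite all_belastE /nilp (nth_last 0 (x :: p)).
Qed.

Lemma computable_bicycleb n a i k t :
  computable n a -> computable n i -> computable n k -> computable n t ->
  computable n (fun v => bicycleb (a v) (decode (i v)) (decode (k v)) (decode (t v))).
Proof.
move=> Ha Hi Hk Ht.
apply: (computable_ext (fun v _ => congr1 nat_of_bool (congr2 andb
  (esym (bicycle_shapeE _ _ _ _)) (esym (etrans (all_cat _ _ _) (congr1 _ (all_cat _ _ _))))))).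
by computable_codes ltac:(first [apply: computable_cycle | apply: computable_sorted
  | apply: computable_notin | apply: computable_all_vertexb]).
Qed.

Lemma computable_spanningb n a i k t :
  computable n a -> computable n i -> computable n k -> computable n t ->
  computable n (fun v => spanningb (a v) (decode (i v)) (decode (k v)) (decode (t v))).
Proof.
move=> Ha Hi Hk Ht; rewrite /spanningb /bicycle_arc.
have mem m x p q r : computable m x -> computable m p -> computable m q ->
  computable m r ->
    computable m (fun v => x v \in decode (p v) ++ decode (q v) ++ decode (r v)).
  move=> Hx Hp Hq Hr; apply: (@computable_ext _ (fun v =>
    [|| x v \in decode (p v), x v \in decode (q v) | x v \in decode (r v)])) => [v _|].
    by rewrite !mem_cat.
  by computable_codes fail.
by computable_codes ltac:(first [apply: mem | apply: computable_code_limit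
  | apply: computable_vertexb | apply: computable_arrowb]).
Qed.

Lemma computable_ambiguousb n a i k t :
  computable n a -> computable n i -> computable n k -> computable n t ->
  computable n (fun v => ambiguousb (a v) (decode (i v)) (decode (k v)) (decode (t v))).
Proof.
move=> Ha Hi Hk Ht; have [f Hf] := amb_dec.
apply: (computable_oracle (f := f) (q := fun v =>
   CodeSeq.code [:: a v; (a v).+2; i v; k v; t v])).
- by computable_codes ltac:(first [apply: computable_valid_basis |
  apply: computable_bicycleb]).
- do 5!(apply: computable_code_cons; first by computable_codes fail).
  exact: computable_const.
move=> v _ /andP[vB bb].
have [|yes no] := Hf (instance (a v) (decode (i v)) (decode (k v)) (decode (t v))).
  split; [exact: all_in_basis|exact: max_length_basis|exact: decoded_bicycleP].
rewrite code_instance // !CodeSeq.decodeK in yes no.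
by case: asboolP.
Qed.

Lemma computable_jointb n a : computable n a -> computable n (fun v => jointb (a v)).
Proof.
move=> Ha; rewrite /jointb /small_jointb /short_belowb /connectedb /gate_foundb /bicycle_foundb.
by computable_codes ltac:(first [apply: computable_code_limit |
  apply: computable_list_limit
  | apply: computable_vertexb | apply: computable_memberb | apply: computable_reachb
  | apply: computable_gateb | apply: computable_bicycleb | apply: computable_spanningb
  | apply: computable_ambiguousb]).
Qed.

Lemma valid_basis_code B : all_in X B -> valid_basis (code_structures sg B).
Proof.
rewrite /code_structures /valid_basis CodeSeq.codeK.
elim: B => //= b B IH XB; rewrite in_type_code; last by apply: XB; left.
by apply: IH => b' Bb'; apply: XB; right.
Qed.

Lemma In_map (T S : Type) (f : T -> S) y l :
  List.In y (map f l) <-> exists2 x, List.In x l & y = f x.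
Proof.
elim: l => [|x l IH] /=; first by split=> // -[].
rewrite IH; split=> [[<-|[z zl ->]]|[z [<-|zl] ->]]; first by exists x; [left|].
- by exists z; [right|].
- by left.
by right; exists z.
Qed.

(** Decoding a coded basis yields isomorphic copies of its members, which exclude
the same structures. *)
Lemma Av_basis_of B : Av sg X (basis_of (code_structures sg B)) = Av sg X B.
Proof.
apply/funext => s; apply/propext; rewrite /basis_of CodeSeq.codeK -map_comp.
split=> -[Xs H]; split=> // b.
  move=> Bb bs; apply: (H (dec (c b))); first by apply/In_map; exists b.
  by apply: cle_code bs; rewrite ?code_dec_code.
by case/In_map=> b' Bb' -> bs; apply: (H b' Bb'); apply: cle_code bs;
  rewrite /= ?code_dec_code.
Qed.

Lemma atomicity_decidable_of_ambiguity : atomicity_decidable sg X.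
Proof.
have [f Hf] := computable_jointb (@computable_proj 1 0 isT).
exists f => B XB; have vB := valid_basis_code XB.
rewrite atomic_joint -Av_basis_of.
have := Hf [:: code_structures sg B] erefl; rewrite /=.
by case: (jointbP vB) => J ev; split.
Qed.

End Decision.

Theorem corollary8p5 (sg : seq nat) (X : structure -> Prop)
    (X_type : is_type sg X)
    (X_valid : valid sg X)
    (X_dec : type_decidable sg X)
    (ambiguity_dec : bicycle_ambiguity_decidable sg X) :
  atomicity_decidable sg X.
Proof. exact: atomicity_decidable_of_ambiguity. Qed.
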